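(* For every positive integer $n$, let $M(n)$ be the largest area of the convex hull of a polyhex with $n$ cells (i.e. the maximum, over all polyhexes with $n$ cells, of the area of the convex hull of the union of the cells). Then $$M(n)=\frac16\left\lceil n^2+\frac{14}{3}n\right\rceil=\frac16\left(\left\lfloor n^2+\frac{14}{3}n+1\right\rfloor-[\,3\mid n\,]\right).$$
   Context: Consider the tiling of the Euclidean plane by congruent regular hexagons, each (closed) hexagonal cell having area one. Two distinct cells are adjacent if they share an edge. A polyhex with $n$ cells is a set of $n$ cells of this tiling that is edge-connected, meaning that the graph on these cells given by adjacency is connected. The convex hull of a polyhex means the convex hull of the union of its cells. Area is Lebesgue measure in the plane. The symbol $[\,3\mid n\,]$ equals $1$ if $3$ divides $n$ and $0$ otherwise. Equivalent coordinate model: in axial coordinates the cell centres are the points of $\mathbb Z^2$, the six neighbours of a centre are obtained by adding $\pm(1,0)$, $\pm(0,1)$, $\pm(1,-1)$, and the cell with centre $p$ is $p+H$ with $H=\operatorname{conv}\{\pm(\tfrac13,\tfrac13),\pm(-\tfrac13,\tfrac23),\pm(\tfrac23,-\tfrac13)\}$, which has area one. The linear map $(q,r)\mapsto\kappa\,(q+\tfrac r2,\tfrac{\sqrt3}{2}r)$ with $\kappa>0$, $\kappa^2=2/\sqrt3$, has determinant one and carries this picture to the regular hexagonal tiling with cells of area one. *)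

(* Defs.v *)
From mathcomp Require Import all_boot all_order all_algebra finmap.
From mathcomp Require Import all_classical all_reals all_analysis.

Set Implicit Arguments.
Unset Strict Implicit.
Unset Printing Implicit Defensive.

Import Order.TTheory GRing.Theory Num.Theory.

Local Open Scope classical_set_scope.
Local Open Scope ring_scope.

Definition plane (R : realType) : lmodType R := (R^o * R^o)%type.

Definition area (R : realType) (A : set (plane R)) : \bar R :=
  ((@lebesgue_measure R) \x (@lebesgue_measure R))%E A.

Definition conv_hull (R : realType) (A : set (plane R)) : set (plane R) :=
  smallest (@convex_set R (plane R)) A.

(* The distance between the centres of adjacent cells, normalised so that the
   cells have area one (kappa ^+ 2 = 2 / sqrt 3). *)
Definition kappa (R : realType) : R := Num.sqrt (2 / Num.sqrt 3).

(* The linear map from axial to Euclidean coordinates; its determinant is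
   kappa ^+ 2 * (sqrt 3 / 2) = 1, and it sends the six vectors of
   axial_vertices below to vectors of equal length, 60 degrees apart, so that
   the cells are regular hexagons. *)
Definition of_axial (R : realType) (q r : R) : plane R :=
  (kappa R * (q + r / 2), kappa R * (Num.sqrt 3 / 2 * r)).

(* Axial coordinates, in thirds, of the vertices of the cell centred at the
   origin, listed counterclockwise. *)
Definition axial_vertices : seq (int * int) :=
  [:: (1, 1); (-1, 2); (-2, 1); (-1, -1); (1, -2); (2, -1)].

(* Cells are indexed by the axial coordinates p of their centres, so that a set
   of cells is given below as a {fset int * int}. *)
Definition vertex (R : realType) (p : int * int) (k : 'I_6) : plane R :=
  let v := nth (0, 0) axial_vertices k in
  of_axial (p.1%:~R + v.1%:~R / 3) (p.2%:~R + v.2%:~R / 3).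
Arguments vertex R p k : clear implicits.

Definition cell (R : realType) (p : int * int) : set (plane R) :=
  conv_hull (range (vertex R p)).
Arguments cell R p : clear implicits.

(* The successor ordS is taken cyclically in 'I_6. *)
Definition edge (R : realType) (p : int * int) (k : 'I_6) : set (plane R) :=
  conv_hull [set vertex R p k; vertex R p (ordS k)].
Arguments edge R p k : clear implicits.

Definition adjacent_cells (R : realType) (p q : int * int) : Prop :=
  p <> q /\ exists k l : 'I_6, edge R p k = edge R q l.
Arguments adjacent_cells R p q : clear implicits.

Definition edge_connected (R : realType) (P : {fset int * int}) : Prop :=
  forall p q : P, connect (fun x y : P => `[< adjacent_cells R (val x) (val y) >]) p q.
Arguments edge_connected R P : clear implicits.

Definition polyhex (R : realType) (n : nat) (P : {fset int * int}) : Prop :=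
  #|` P| = n /\ edge_connected R P.
Arguments polyhex R n P : clear implicits.

Definition hull_area (R : realType) (P : {fset int * int}) : \bar R :=
  area (conv_hull (\bigcup_(p in [set` P]) cell R p)).
Arguments hull_area R P : clear implicits.

Definition hull_areas (R : realType) (n : nat) : set (\bar R) :=
  [set hull_area R P | P in [set P | polyhex R n P]].
Arguments hull_areas R n : clear implicits.

Definition max_hull_area (R : realType) (n : nat) : \bar R :=
  ereal_sup (hull_areas R n).
Arguments max_hull_area R n : clear implicits.

(* Main.v *)
Require Import Defs.
From mathcomp Require Import all_boot all_order all_algebra finmap.
From mathcomp Require Import all_classical all_reals all_analysis.
From mathcomp Require Import measurable_realfun zify ring lra.

Set Implicit Arguments.
Unset Strict Implicit.
Unset Printing Implicit Defensive.

Import Order.TTheory GRing.Theory Num.Theory.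
Import numFieldNormedType.Exports.

Local Open Scope classical_set_scope.
Local Open Scope ring_scope.

(** In axial coordinates the cell with centre [p] is [p + H], where the hexagon
    [H] is the sum of three segments parallel to its sides.  If [C] is the convex
    hull of the centres, the convex hull of the cells is therefore [C + H].
    Adding a segment [[0, v]] to a convex body increases its area by its width
    in the direction of the functional [det (v, _)] ([area_sweep]); doing so
    three times gives the exact formula
      area (C + H) = area C + W / 3 + 1                      ([area_fatten]),
    where [W] is the sum of the widths of [C] for the functionals [q + 2 r],
    [2 q + r] and [q - r].

    For the upper bound, grow a spanning tree of the polyhex leaf by leaf, and
    let [a], [b], [c] count its edges parallel to [(1, 0)], [(0, 1)], [(1, -1)],
    so that [a + b + c = n - 1].  Two independent estimates hold.

    - [2 area C <= a b + b c + c a] ([area_grown]).  A new leaf [p + e], attached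
      to [p], enlarges the hull [C] only within [C + [0, e]]: on the line
      parallel to [e] at distance [t] the slice grows by at most a tent function
      of [t] whose top is at [p], so the area grows by at most half the width of
      [C] transverse to [e] ([area_cone]).  The edges parallel to [e] do not
      contribute to that width, and each other edge contributes at most one.

    - [W <= 3 (a + b + c) + max (a, b, c)] ([spread_boundP]).  Choose extreme
      points [x_i], [y_i] of the three functionals.  An edge splits the tree in
      two parts and contributes to [W] according to how the six points are
      distributed.  The contribution is at most 4, and it is 4 only for one
      splitting: [x_1 x_2 x_3] from [y_1 y_2 y_3] if the edge is of the first
      kind, [x_1 x_2 y_3] from [y_1 y_2 x_3] for the second, [y_1 x_2 x_3] from
      [x_1 y_2 y_3] for the third.  Two different such splittings cross each
      other, which edges of one tree cannot do; so all edges that contribute 4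
      are of the same kind.

    Together, [6 area <= 3 (a b + b c + c a) + 6 (n - 1) + 2 max (a, b, c) + 6],
    and the integral maximum of the right-hand side is [ceil (n^2 + 14 n / 3)]
    ([extremal_arith]).

    Equality holds for three straight legs, half of a hexagon: first along
    [(1, 0)], then along [(0, 1)], then along [(-1, 1)], of nearly equal
    lengths ([hull_area_horseshoe]).  There [C] is a trapezium whose area is
    found by slicing, and the formula above is exact. *)

(** * Widths of a growing tree *)

(** The normals of the three pairs of parallel sides of a cell, scaled so that
    they take integral values at the centres. *)
Definition normal1 (x : int * int) : int := x.1 + x.2 *+ 2.
Definition normal2 (x : int * int) : int := x.1 *+ 2 + x.2.
Definition normal3 (x : int * int) : int := x.1 - x.2.

(** The vertex lists of trees, the last attached leaf first, together with the
    numbers of edges in each of the three lattice directions. *)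
Inductive grown : nat -> nat -> nat -> seq (int * int) -> Prop :=
| grown1 p : grown 0 0 0 [:: p]
| grownA a b c s (p : int * int) (e : int) of grown a b c s & p \in s & e \in [:: 1; -1] :
    grown a.+1 b c ((p.1 + e, p.2) :: s)
| grownB a b c s (p : int * int) (e : int) of grown a b c s & p \in s & e \in [:: 1; -1] :
    grown a b.+1 c ((p.1, p.2 + e) :: s)
| grownC a b c s (p : int * int) (e : int) of grown a b c s & p \in s & e \in [:: 1; -1] :
    grown a b c.+1 ((p.1 + e, p.2 - e) :: s).

Definition spread (x1 y1 x2 y2 x3 y3 : int * int) : int :=
  (normal1 x1 - normal1 y1) + (normal2 x2 - normal2 y2) + (normal3 x3 - normal3 y3).

(** A triple that has collapsed to one vertex of the tree cannot be split by the
    edges that remain. *)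
Definition fused (x y z u v w : int * int) :=
  [&& x == y & y == z] || [&& u == v & v == w].

(** The bound on the spread, strengthened so that it can be proved by induction on
    the leaves: once a leaf of some kind has contributed 4, the triple sitting at
    that leaf moves as one point, and no leaf of another kind can contribute 4.
    Which triples are concerned depends on the signs of the functionals along the
    edge: they agree for the first kind, [normal3] differs from the others for the
    second, [normal1] for the third. *)
Definition spread_bound a b c (s : seq (int * int)) := forall x1 y1 x2 y2 x3 y3,
  [/\ x1 \in s, x2 \in s & x3 \in s] -> [/\ y1 \in s, y2 \in s & y3 \in s] ->
  let S := spread x1 y1 x2 y2 x3 y3 in
  let bound m := S <= 3 * (a + b + c)%:Z + m%:Z in
  [/\ forall m, (a <= m)%N -> (b <= m)%N -> (c <= m)%N -> bound m,
    fused x1 x2 x3 y1 y2 y3 -> bound a,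
    fused x1 x2 y3 y1 y2 x3 -> bound b &
    fused y1 x2 x3 x1 y2 y3 -> bound c].

(** Removal of the leaf [q] attached to [p]. *)
Definition retract (q p x : int * int) := if x == q then p else x.

Lemma retract_mem q p s x : p \in s -> x \in q :: s -> retract q p x \in s.
Proof. by rewrite /retract inE; case: eqP. Qed.

Lemma fused_retract q p x y z u v w : fused x y z u v w ->
  fused (retract q p x) (retract q p y) (retract q p z)
        (retract q p u) (retract q p v) (retract q p w).
Proof.
by case/orP=> /andP[/eqP<- /eqP<-]; rewrite /fused !eqxx ?orbT.
Qed.

Section Jump.
Variables (q p x1 y1 x2 y2 x3 y3 : int * int).
Let r := retract q p.
Let jump := spread x1 y1 x2 y2 x3 y3
          - spread (r x1) (r y1) (r x2) (r y2) (r x3) (r y3).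

(** The contribution of the leaf edge to the spread: only the points that sit at
    the leaf move when it is removed. *)
Lemma jumpE : jump =
    ((x1 == q)%:Z - (y1 == q)%:Z) * (normal1 q - normal1 p)
  + ((x2 == q)%:Z - (y2 == q)%:Z) * (normal2 q - normal2 p)
  + ((x3 == q)%:Z - (y3 == q)%:Z) * (normal3 q - normal3 p).
Proof.
have shift (f : int * int -> int) x : f x - f (r x) = (x == q)%:Z * (f q - f p).
  by rewrite /r /retract; case: eqP => [->|_]; rewrite ?mul1r ?mul0r ?subrr.
by rewrite /jump /spread !mulrBl -!shift; ring.
Qed.

Lemma fused_together x y z u v w :
    [&& x == q, y == q & z == q] || [&& u == q, v == q & w == q] ->
  fused (r x) (r y) (r z) (r u) (r v) (r w).
Proof.
by case/orP=> /and3P[/eqP-> /eqP-> /eqP->]; rewrite /fused !eqxx ?orbT.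
Qed.

End Jump.

(** An edge changes one of the functionals by 2 and the other two by 1, so that 4
    is reached only if one triple sits at the leaf and no point of the other does.
    The first pair is the one for the functional that changes by 2. *)
Lemma jump_le3_or_split (b1 b2 b3 c1 c2 c3 : bool) (e : int) : e \in [:: 1; -1] ->
  let d := ((b1%:Z - c1%:Z) *+ 2 + (b2%:Z - c2%:Z) + (b3%:Z - c3%:Z)) * e in
  d <= 3 \/ exists t, d = 4 /\
    (b1, b2, b3, c1, c2, c3) = (t, t, t, ~~ t, ~~ t, ~~ t).
Proof.
rewrite !inE => /orP[] /eqP->; case: b1; case: b2; case: b3;
  case: c1; case: c2; case: c3; rewrite /=;
  try (by left); by right; (exists true + exists false).
Qed.

Lemma fused_mem q x y z u v w : fused x y z u v w ->
  ((x == q) = (y == q) /\ (y == q) = (z == q))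
  \/ ((u == q) = (v == q) /\ (v == q) = (w == q)).
Proof. by case/orP=> /andP[/eqP-> /eqP->]; [left|right]. Qed.

(** If the leaf contributes at most 3, the bounds for the retracted points suffice.
    If it contributes 4, then the retracted triple is fused, which gives the
    stronger bound for the kind of the removed edge; and no triple of another kind
    was fused, since it would be split by this edge. *)
Lemma spread_boundP a b c s : grown a b c s -> spread_bound a b c s.
Proof.
elim=> {a b c s} [p|a b c s p e _ IH ps es|a b c s p e _ IH ps es|a b c s p e _ IH ps es].
- move=> x1 y1 x2 y2 x3 y3 []; rewrite !inE => /eqP-> /eqP-> /eqP->.
  case=> /eqP-> /eqP-> /eqP->.
  by rewrite /spread !subrr; split=> *; lia.
all: move=> x1 y1 x2 y2 x3 y3 [x1s x2s x3s] [y1s y2s y3s] /=.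
all: have [I0 IA IB IC] := IH _ _ _ _ _ _
  (And3 (retract_mem ps x1s) (retract_mem ps x2s) (retract_mem ps x3s))
  (And3 (retract_mem ps y1s) (retract_mem ps y2s) (retract_mem ps y3s)).
all: set q := (_, _) in I0 IA IB IC *.
all: have J := jumpE q p x1 y1 x2 y2 x3 y3.
all: have T := @fused_together q p; have M := @fused_mem q; have F := @fused_retract q p.
all: move: J I0 IA IB IC; rewrite /=.
all: set S := spread x1 _ _ _ _ _; set S' := spread _ _ _ _ _ _; move=> J I0 IA IB IC.
- have [d3|[t [d4 split]]] := jump_le3_or_split
    (x2 == q) (x1 == q) (x3 == q) (y2 == q) (y1 == q) (y3 == q) es.
  + have {J d3} J : S - S' <= 3.
      rewrite (le_trans _ d3)// J /normal1 /normal2 /normal3 /q /= le_eqVlt.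
      by apply/orP; left; apply/eqP; ring.
    split=> [m am bm cm|/F/IA h|/F/IB h|/F/IC h]; last 3 first.
    1-3: by move: h J; clear; lia.
    by have h := I0 m (ltnW am) bm cm; move: h J; clear; lia.
  + have {J d4} J : S - S' = 4 by rewrite -d4 J /normal1 /normal2 /normal3 /q /=; ring.
    case: split => t2 t1 t3 u2 u1 u3.
    have {IA} IA : S' <= 3 * (a + b + c)%:Z + a%:Z.
      by apply/IA/T; rewrite t1 t2 t3 u1 u2 u3; case: (t).
    split=> [m lem _ _|_|/M|/M].
    1,2: by move: J IA; try move: lem; clear; lia.
    1,2: by rewrite ?(t1, t2, t3, u1, u2, u3); case: (t) => -[] [].
- have [d3|[t [d4 split]]] := jump_le3_or_split
    (x1 == q) (x2 == q) (y3 == q) (y1 == q) (y2 == q) (x3 == q) es.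
  + have {J d3} J : S - S' <= 3.
      rewrite (le_trans _ d3)// J /normal1 /normal2 /normal3 /q /= le_eqVlt.
      by apply/orP; left; apply/eqP; ring.
    split=> [m am bm cm|/F/IA h|/F/IB h|/F/IC h]; last 3 first.
    1-3: by move: h J; clear; lia.
    by have h := I0 m am (ltnW bm) cm; move: h J; clear; lia.
  + have {J d4} J : S - S' = 4 by rewrite -d4 J /normal1 /normal2 /normal3 /q /=; ring.
    case: split => t1 t2 u3 u1 u2 t3.
    have {IB} IB : S' <= 3 * (a + b + c)%:Z + b%:Z.
      by apply/IB/T; rewrite t1 t2 t3 u1 u2 u3; case: (t).
    split=> [m _ lem _|/M|_|/M].
    1,3: by move: J IB; try move: lem; clear; lia.
    1,2: by rewrite ?(t1, t2, t3, u1, u2, u3); case: (t) => -[] [].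
- have [d3|[t [d4 split]]] := jump_le3_or_split
    (x3 == q) (y1 == q) (x2 == q) (y3 == q) (x1 == q) (y2 == q) es.
  + have {J d3} J : S - S' <= 3.
      rewrite (le_trans _ d3)// J /normal1 /normal2 /normal3 /q /= le_eqVlt.
      by apply/orP; left; apply/eqP; ring.
    split=> [m am bm cm|/F/IA h|/F/IB h|/F/IC h]; last 3 first.
    1-3: by move: h J; clear; lia.
    by have h := I0 m am bm (ltnW cm); move: h J; clear; lia.
  + have {J d4} J : S - S' = 4 by rewrite -d4 J /normal1 /normal2 /normal3 /q /=; ring.
    case: split => t3 u1 t2 u3 t1 u2.
    have {IC} IC : S' <= 3 * (a + b + c)%:Z + c%:Z.
      by apply/IC/T; rewrite t1 t2 t3 u1 u2 u3; case: (t).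
    split=> [m _ _ lem|/M|/M|_].
    1,4: by move: J IC; try move: lem; clear; lia.
    1,2: by rewrite ?(t1, t2, t3, u1, u2, u3); case: (t) => -[] [].
Qed.

(** The functional transverse to a lattice direction vanishes on the edges parallel
    to it and is at most one on the others. *)
Lemma grown_range a b c s : grown a b c s -> forall x y : int * int,
  x \in s -> y \in s ->
  [/\ x.2 - y.2 <= (b + c)%:Z, x.1 - y.1 <= (a + c)%:Z &
      (x.1 + x.2) - (y.1 + y.2) <= (a + b)%:Z].
Proof.
elim=> {a b c s} [p|a b c s p e _ IH ps es|a b c s p e _ IH ps es
  |a b c s p e _ IH ps es] x y.
  by rewrite !inE => /eqP-> /eqP->; rewrite !subrr.
all: have {es} [le_e ge_e] : e <= 1 /\ - e <= 1.
all: try by move: es; rewrite !inE => /orP[] /eqP->.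
all: move=> xs ys; have [] := IH _ _ (retract_mem ps xs) (retract_mem ps ys).
all: rewrite /retract; case: eqP => [->|_]; case: eqP => [->|_] /=.
all: by move: le_e ge_e; clear; move=> *; split; lia.
Qed.

(** * The integral maximum *)

(** With [x] and [y] the differences between the greatest of [a, b, c] and the other
    two, this is the defect in [extremal_arith].  Over the reals it is negative
    near [x = y = 2 / 3]; at integral points only [x + y = 1] needs care. *)
Lemma defect_ge0 (x y : int) : 0 <= x -> 0 <= y ->
  0 <= 3 * (x ^+ 2 + y ^+ 2 - x * y) - 2 * (x + y) + 1.
Proof.
move=> x0 y0; case: (x + y =P 1) => [E|/eqP ne1].
  have -> : y = 1 - x by lia.
  have /orP[/eqP->|/eqP->] // : (x == 0) || (x == 1) by lia.
have -> : y = (x + y) - x by ring.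
have : (x + y <= 0) || (2 <= x + y) by lia.
move: (x + y) => t /orP h.
have : 0 <= (3 * t - 2) * (t - 2) by case: h => h; nia.
by nia.
Qed.

Lemma extremal_arith (a b c m : nat) : m \in [:: a; b; c] ->
  (a <= m)%N -> (b <= m)%N -> (c <= m)%N ->
  9 * (a * b + b * c + c * a)%:Z + 6 * m%:Z <=
  3 * (a + b + c)%:Z ^+ 2 + 2 * (a + b + c)%:Z + 1.
Proof.
move=> mE am bm cm; have E : m = a \/ m = b \/ m = c.
  by move: mE; rewrite !inE => /or3P[] /eqP; auto.
have dist (u v w : nat) : (v <= u)%N -> (w <= u)%N ->
    9 * (u * v + v * w + w * u)%:Z + 6 * u%:Z
     <= 3 * (u + v + w)%:Z ^+ 2 + 2 * (u + v + w)%:Z + 1.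
  move=> vu wu; have /(_ (u%:Z - w%:Z)) := @defect_ge0 (u%:Z - v%:Z).
  by rewrite !PoszD !PoszM => /(_ ltac:(lia) ltac:(lia)); lia.
case: E am bm cm => [|[]] -> h1 h2 h3.
- by move: (dist a b c h2 h3); rewrite !PoszD !PoszM; lia.
- by move: (dist b c a h3 h1); rewrite !PoszD !PoszM; lia.
- by move: (dist c a b h1 h2); rewrite !PoszD !PoszM; lia.
Qed.

(** * Convex bodies and their slices *)

Section Slices.
Variable R : realType.
Implicit Types (K : set (R * R)) (x y z : R * R) (t : R).

Definition mix t x y : R * R := ((1 - t) * x.1 + t * y.1, (1 - t) * x.2 + t * y.2).

Definition mix_closed K :=
  forall x y t, K x -> K y -> 0 <= t <= 1 -> K (mix t x y).

Definition body K := compact K /\ mix_closed K.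

(** The product sigma-algebra contains the open sets because these are countable
    unions of boxes with rational corners. *)
Lemma open_measurable_plane (U : set (R * R)) : open U -> measurable U.
Proof.
move=> oU.
pose box (q : (rat * rat) * (rat * rat)) : set (R * R) :=
  `]ratr q.1.1, ratr q.1.2[%classic `*` `]ratr q.2.1, ratr q.2.2[%classic.
have -> : U = \bigcup_q (if `[< box q `<=` U >] then box q else set0).
  apply/seteqP; split => [[a b] Uab|z [q _]]; last by case: asboolP => // h /h.
  have /nbhs_ballP[/= e e0 eU] : nbhs (a, b) U by exact: open_nbhs_nbhs.
  have le : a - e < a by rewrite gtrBl.
  have re : a < a + e by rewrite ltrDl.
  have le' : b - e < b by rewrite gtrBl.
  have re' : b < b + e by rewrite ltrDl.
  have [p1 p1P] := rat_in_itvoo le; have [p2 p2P] := rat_in_itvoo re.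
  have [p3 p3P] := rat_in_itvoo le'; have [p4 p4P] := rat_in_itvoo re'.
  move: p1P p2P p3P p4P; rewrite !in_itv/= => /andP[h1 h2] /andP[h3 h4] /andP[h5 h6] /andP[h7 h8].
  exists ((p1, p2), (p3, p4)) => //; case: asboolP => [_|[]].
    by rewrite /box; split; rewrite /= in_itv/= ?h2 ?h3 ?h6 ?h7.
  move=> [u v] [/=]; rewrite !in_itv/= => /andP[i1 i2] /andP[i3 i4].
  apply: eU; split; rewrite /ball/= ltr_norml; lra.
apply: countable_bigcupT_measurable; first exact: countableP.
move=> q; case: asboolP => _; last exact: measurable0.
by apply: measurableX; exact: measurable_itv.
Qed.

Lemma compact_measurable_plane K : compact K -> measurable K.
Proof.
move=> /compact_closed => /(_ (@norm_hausdorff _ (R^o * R^o)%type)).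
by move/closed_openC/open_measurable_plane/measurableC; rewrite setCK.
Qed.

Lemma body_measurable K : body K -> measurable K.
Proof. by case=> /compact_measurable_plane. Qed.

Lemma body_slice K a : body K ->
  xsection K a = set0 \/ exists l r, l <= r /\ xsection K a = `[l, r]%classic.
Proof.
move=> [cK vK].
have [->|/set0P S0] := eqVneq (xsection K a) set0; [by left|right].
have cS : compact (xsection K a).
  have -> : xsection K a = snd @` (K `&` (fst @^-1` [set a])).
    apply/seteqP; split => [b /xsectionP Kab|_ [[a' b] [Kb /= <-]] <-].
      by exists (a, b).
    exact/xsectionP.
  apply: continuous_compact; first by apply: continuous_subspaceT => z; exact: cvg_snd.
  apply: compact_closedI => //.
  apply: (@closed_comp _ _ fst); first by move=> z _; exact: cvg_fst.
  exact: closed_eq.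
have cid : {within xsection K a, continuous (id : R -> R)}.
  by apply: continuous_subspaceT => z.
have [r /set_mem Sr rmax] := compact_EVT_max S0 cS cid.
have [l /set_mem Sl lmin] := compact_EVT_min S0 cS cid.
exists l, r; split; first by apply: rmax; exact: mem_set.
apply/seteqP; split => [b Sb /=|b /=]; rewrite in_itv/=.
  by rewrite lmin ?rmax// mem_set.
move=> /andP[lb br]; move: Sl Sr => /xsectionP Kl /xsectionP Kr; apply/xsectionP.
have [E|lr] := eqVneq l r.
  by have -> : b = l by apply/le_anti; rewrite lb E br.
have lr0 : 0 < r - l by rewrite subr_gt0 lt_neqAle lr (le_trans lb).
have t01 : 0 <= (b - l) / (r - l) <= 1.
  by rewrite ler_pdivrMr// mul1r lerD2r br divr_ge0 ?subr_ge0// (le_trans lb).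
have := vK _ _ _ Kl Kr t01; rewrite /mix/=.
have -> : (1 - (b - l) / (r - l)) * a + (b - l) / (r - l) * a = a by ring.
by have -> : (1 - (b - l) / (r - l)) * l + (b - l) / (r - l) * r = b
  by field; rewrite lt0r_neq0.
Qed.
End Slices.

(** * Invariance of the area under unimodular maps *)

Section Linear.
Variable R : realType.
Implicit Types (K : set (R * R)).
Local Notation leb := (@lebesgue_measure R).

Lemma areaE K : area K = (\int[leb]_x leb (xsection K x))%E.
Proof. by []. Qed.

Definition lin (a b c d : R) (z : R * R) : R * R := (a * z.1 + b * z.2, c * z.1 + d * z.2).

Lemma lin_comp a b c d a' b' c' d' (z : R * R) : lin a b c d (lin a' b' c' d' z) =
  lin (a * a' + b * c') (a * b' + b * d') (c * a' + d * c') (c * b' + d * d') z.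
Proof. by congr pair; rewrite /lin/=; ring. Qed.

Lemma lin_mix a b c d t (x y : R * R) : lin a b c d (mix t x y) =
  mix t (lin a b c d x) (lin a b c d y).
Proof. by congr pair; rewrite /lin/=; ring. Qed.

Lemma continuous_pair (T : topologicalType) (f g : T -> R) :
  continuous f -> continuous g -> continuous (fun u => (f u, g u) : R * R).
Proof. by move=> cf cg u; exact: (cvg_pair (cf u) (cg u)). Qed.

Lemma continuous_coord1 : continuous (fst : R * R -> R).
Proof. by move=> z; exact: cvg_fst. Qed.

Lemma continuous_coord2 : continuous (snd : R * R -> R).
Proof. by move=> z; exact: cvg_snd. Qed.

Lemma continuous_lin a b c d : continuous (lin a b c d : R * R -> R * R).
Proof.
have cf (u v : R) : continuous (fun z : R * R => u * z.1 + v * z.2 : R).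
  move=> z.
  by apply: (@continuousD _ R^o _ (fun z => u * z.1) (fun z => v * z.2));
    apply: (@continuousM _ _ (fun=> _));
    [exact: cst_continuous|exact: continuous_coord1
    |exact: cst_continuous|exact: continuous_coord2].
by apply: continuous_pair; exact: cf.
Qed.

Lemma mix_closed_lin a b c d K : mix_closed K -> mix_closed (lin a b c d @` K).
Proof.
move=> vK _ _ t [x Kx <-] [y Ky <-] t01; exists (mix t x y); first exact: vK.
exact: lin_mix.
Qed.

Lemma body_lin a b c d K : body K -> body (lin a b c d @` K).
Proof.
move=> [cK vK]; split; last exact: mix_closed_lin.
by apply: continuous_compact => //; apply/continuous_subspaceT/continuous_lin.
Qed.

Lemma lebesgue_segment (l r : R) : l <= r -> leb `[l, r]%classic = (r - l)%:E.
Proof.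
rewrite le_eqVlt lebesgue_measure_itv/= lte_fin => /predU1P[->|->].
  by rewrite ltxx subrr.
by rewrite EFinB.
Qed.

(** A vertical shear translates each vertical slice, and the slices of a convex
    body are segments; so translation invariance is only needed for segments. *)
Lemma area_vshear c K : body K -> area (lin 1 0 c 1 @` K) = area K.
Proof.
move=> bK; rewrite !areaE; apply: eq_integral => x _.
have -> : xsection (lin 1 0 c 1 @` K) x = (fun y => c * x + y) @` xsection K x.
  apply/seteqP; split => [y /xsectionP[[x' y'] Ky [E <-]]|_ [y /xsectionP Ky <-]].
    exists y'; first by apply/xsectionP; rewrite -E /= mul0r mul1r addr0.
    by rewrite -E /=; ring.
  by apply/xsectionP; exists (x, y) => //; congr pair => /=; ring.
have [->|[l [r [lr ->]]]] := body_slice x bK; first by rewrite image_set0.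
have -> : (fun y => c * x + y) @` `[l, r] = `[c * x + l, c * x + r]%classic.
  apply/seteqP; split => [_ [y + <-]|y] /=; rewrite !in_itv/= ?lerD2l// => h.
  by exists (y - c * x); rewrite ?in_itv/=; [lra|ring].
by rewrite !lebesgue_segment ?lerD2l//; congr EFin; ring.
Qed.

(** Symmetry of the product measure, by its uniqueness. *)
Lemma area_swap K : measurable K -> area (lin 0 1 1 0 @` K) = area K.
Proof.
move=> mK.
have -> : area K = (leb \x^ leb)%E K.
  by apply: product_measure_unique => // A B mA mB; exact: product_measure2E.
rewrite areaE; apply: eq_integral => x _; congr (leb _).
apply/seteqP; split => [y /xsectionP[[x' y'] Ky [<- <-]]|y /ysectionP Ky].
  by apply/ysectionP => /=; rewrite !mul0r !mul1r add0r addr0.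
by apply/xsectionP; exists (y, x) => //; congr pair => /=; ring.
Qed.

(** A unimodular matrix with non-zero lower left entry is a product of three
    shears, horizontal, vertical, horizontal; horizontal shears reduce to vertical
    ones by exchanging the coordinates.  If the entry is zero, a further vertical
    shear makes it non-zero. *)
Lemma area_lin a b c d K : a * d - b * c = 1 -> body K ->
  area (lin a b c d @` K) = area K.
Proof.
have imageE (a1 b1 c1 d1 a2 b2 c2 d2 a3 b3 c3 d3 : R) K' :
    a1 * a2 + b1 * c2 = a3 -> a1 * b2 + b1 * d2 = b3 ->
    c1 * a2 + d1 * c2 = c3 -> c1 * b2 + d1 * d2 = d3 ->
    lin a3 b3 c3 d3 @` K' = lin a1 b1 c1 d1 @` (lin a2 b2 c2 d2 @` K').
  move=> <- <- <- <-; rewrite image_comp; congr image.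
  by apply/funext => z /=; rewrite lin_comp.
have hshear b' K' : body K' -> area (lin 1 b' 0 1 @` K') = area K'.
  move=> bK; rewrite (imageE 0 1 1 0 0 1 1 b'); [|ring..].
  rewrite [X in lin 0 1 1 0 @` X](imageE 1 0 b' 1 0 1 1 0); [|ring..].
  rewrite area_swap; last by apply: body_measurable; do 2 apply: body_lin.
  rewrite area_vshear; last exact: body_lin.
  by apply: area_swap; apply: body_measurable.
have main a' b' c' d' K' : c' != 0 -> a' * d' - b' * c' = 1 -> body K' ->
    area (lin a' b' c' d' @` K') = area K'.
  move=> c0 det1 bK.
  have bE : 1 * ((d' - 1) / c') + (a' - 1) / c' * d' = b'.
    by have -> : b' = (a' * d' - 1) / c' by [rewrite -det1; field]; field.
  rewrite (imageE 1 ((a' - 1) / c') 0 1 1 ((d' - 1) / c') c' d' a' b' c' d' _ _ bE);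
    [|by field..].
  rewrite [X in lin _ _ 0 1 @` X](imageE 1 0 c' 1 1 ((d' - 1) / c') 0 1); [|by field..].
  rewrite hshear ?area_vshear ?hshear//; do ?exact: body_lin.
  by do 2 apply: body_lin.
have [->|c0] := eqVneq c 0; last exact: main.
rewrite mulr0 subr0 => ad1 bK.
have a0 : a != 0 by apply: contra_eq_neq ad1 => ->; rewrite mul0r eq_sym oner_eq0.
rewrite (imageE 1 0 (-1) 1 a b a (b + d)); [|ring..].
rewrite area_vshear; last exact: body_lin.
by apply: main => //; rewrite -ad1; ring.
Qed.
End Linear.

(** * Integrals of affine and tent functions *)

Section Integrals.
Variable R : realType.
Local Notation leb := (@lebesgue_measure R).

Lemma integral_affine (u w a b : R) : a <= b ->
  (\int[leb]_(x in `[a, b]) (u * x + w)%:E =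
   (u * (b ^+ 2 - a ^+ 2) / 2 + w * (b - a))%:E)%E.
Proof.
rewrite le_eqVlt => /predU1P[<-|ab].
  by rewrite set_itv1 integral_set1 !subrr mulr0 mul0r mulr0 addr0.
pose F (x : R) := u / 2 * x ^+ 2 + w * x.
have dF (x : R) : is_derive x 1 F (u * x + w).
  by apply: is_derive_eq; rewrite /GRing.scale/= !mulr1; field.
have cF : continuous F.
  by move=> y; apply/differentiable_continuous/derivable1_diffP; case: (dF y).
rewrite (@continuous_FTC2 _ _ F)//.
- by rewrite -EFinB /F; congr EFin; ring.
- apply: continuous_subspaceT => y.
  by apply: (@continuousD _ R^o _ (fun z => u * z) (fun=> w));
    [apply: (@continuousM _ _ (fun=> _)); [exact: cst_continuous|exact: cvg_id]
    |exact: cst_continuous].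
- split; first by move=> y _; case: (dF y).
  + by apply: cvg_at_right_filter; exact: cF.
  + by apply: cvg_at_left_filter; exact: cF.
- by move=> y _; rewrite derive1E; case: (dF y).
Qed.
Lemma integral_on (f : R -> R) (A : set R) :
  (\int[leb]_x (f x * \1_A x)%:E = \int[leb]_(x in A) (f x)%:E)%E.
Proof.
rewrite [RHS]integral_mkcond; apply: eq_integral => x _; rewrite patchE indicE.
by case: (x \in A); rewrite ?mulr1 ?mulr0.
Qed.

Lemma measurable_affine_on (u w : R) (A : set R) : measurable A ->
  measurable_fun setT (fun x : R => (u * x + w) * \1_A x).
Proof.
move=> mA; apply: measurable_funM; last exact: measurable_indic.
by apply: measurable_funD => //; apply: measurable_funM.
Qed.

(** The piecewise affine function supported by [[m, M]] that vanishes at [m] and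
    [M] and equals 1 at [c].  The value at [c] is a separate summand, so that the
    degenerate cases [c = m] and [c = M] are included. *)
Definition tent (m c M x : R) : R :=
  (((c - m)^-1 * x - m / (c - m)) * \1_`[m, c[ x + \1_[set c] x) +
  (- (M - c)^-1 * x + M / (M - c)) * \1_`]c, M] x.

Lemma ascent_ge0 (m c x : R) : 0 <= ((c - m)^-1 * x - m / (c - m)) * \1_`[m, c[ x.
Proof.
rewrite indicE mem_setE/= in_itv/=; case: andP => [[mx xc]|_]; last by rewrite mulr0.
rewrite mulr1 [X in X - _]mulrC -mulrBl divr_ge0//; lra.
Qed.

Lemma descent_ge0 (c M x : R) : 0 <= (- (M - c)^-1 * x + M / (M - c)) * \1_`]c, M] x.
Proof.
rewrite indicE mem_setE/= in_itv/=; case: andP => [[mx xc]|_]; last by rewrite mulr0.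
rewrite mulr1 mulNr mulrC addrC -mulrBl divr_ge0//; lra.
Qed.

Lemma tent_ge0 m c M x : 0 <= tent m c M x.
Proof. by rewrite !addr_ge0 ?ascent_ge0 ?descent_ge0 ?indicE. Qed.

Lemma measurable_tent m c M : measurable_fun setT (tent m c M).
Proof.
by apply: measurable_funD; [apply: measurable_funD|]; try exact: measurable_affine_on;
  apply: measurable_indic.
Qed.

Lemma integral_ascent (m c : R) : m <= c ->
  (\int[leb]_x (((c - m)^-1 * x - m / (c - m)) * \1_`[m, c[ x)%:E = ((c - m) / 2)%:E)%E.
Proof.
move=> mc; rewrite integral_on.
move: (mc); rewrite le_eqVlt => /predU1P[->|lt].
  by rewrite subrr mul0r set_itvco0 integral_set0.
rewrite integral_itv_bndo_bndc; last first.
  apply/measurable_EFinP; apply: measurable_funD => //; exact: measurable_funM.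
rewrite integral_affine//; congr EFin.
by field; rewrite subr_eq0 gt_eqF.
Qed.

Lemma integral_descent (c M : R) : c <= M ->
  (\int[leb]_x ((- (M - c)^-1 * x + M / (M - c)) * \1_`]c, M] x)%:E = ((M - c) / 2)%:E)%E.
Proof.
move=> mc; rewrite integral_on.
move: (mc); rewrite le_eqVlt => /predU1P[->|lt].
  by rewrite subrr mul0r set_itvoc0 integral_set0.
rewrite integral_itv_obnd_cbnd; last first.
  apply/measurable_EFinP; apply: measurable_funD => //; exact: measurable_funM.
rewrite integral_affine//; congr EFin.
by field; rewrite subr_eq0 gt_eqF.
Qed.

Lemma integral_tent (m c M : R) : m <= c -> c <= M ->
  (\int[leb]_x (tent m c M x)%:E = ((M - m) / 2)%:E)%E.
Proof.
move=> mc cM; rewrite /tent.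
under eq_integral do rewrite 2!EFinD.
rewrite ge0_integralD//; first last.
- by apply/measurable_EFinP; exact: measurable_affine_on.
- by move=> x _; rewrite lee_fin descent_ge0.
- apply: emeasurable_funD; apply/measurable_EFinP; last exact: measurable_indic.
  exact: measurable_affine_on.
- by move=> x _; rewrite -EFinD lee_fin addr_ge0 ?ascent_ge0 ?indicE.
rewrite ge0_integralD//; first last.
- by apply/measurable_EFinP; exact: measurable_indic.
- by apply/measurable_EFinP; exact: measurable_affine_on.
- by move=> x _; rewrite lee_fin ascent_ge0.
rewrite integral_ascent// integral_descent// integral_indic// setIT.
rewrite [X in (_ + X + _)%E](_ : _ = 0%E); last exact: lebesgue_measure_set1.
by rewrite adde0 -EFinD; congr EFin; field.
Qed.

End Integrals.

(** * Sweeping a body along a segment, and cones over a body *)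

Section Growth.
Variable R : realType.
Implicit Types (K : set (R * R)) (v p lo hi : R * R).
Local Notation leb := (@lebesgue_measure R).

Definition slide (t : R) (v z : R * R) : R * R := (z.1 + t * v.1, z.2 + t * v.2).

Definition sweep (v : R * R) K := [set slide q.1 v q.2 | q in `[0, 1]%classic `*` K].

Definition cone (p : R * R) K := [set mix q.1 q.2 p | q in `[0, 1]%classic `*` K].

Definition cross (v z : R * R) : R := z.1 * v.2 - z.2 * v.1.

Definition extremes (f : R * R -> R) K lo hi :=
  [/\ K lo, K hi & forall z, K z -> f lo <= f z <= f hi].

Lemma mix_closed_sweep v K : mix_closed K -> mix_closed (sweep v K).
Proof.
move=> vK _ _ t [[a x] [/= + Kx] <-] [[b y] [/= + Ky] <-] t01.
rewrite !in_itv/= => a01 b01.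
exists ((1 - t) * a + t * b, mix t x y).
  by split; [rewrite /= in_itv/=; nra|exact: vK].
by rewrite /slide /mix/=; congr pair; ring.
Qed.

Lemma body_sweep v K : body K -> body (sweep v K).
Proof.
move=> [cK vK]; split; last exact: mix_closed_sweep.
apply: continuous_compact; last by apply: compact_setX => //; exact: segment_compact.
apply: continuous_subspaceT.
have c (w : R) (g : R * R -> R) : continuous g ->
    continuous (fun q : R * (R * R) => g q.2 + q.1 * w).
  move=> cg q; apply: (@continuousD _ R^o _ (fun q : R * (R * R) => g q.2) (fun q => q.1 * w)).
    by apply: (@continuous_comp _ _ _ snd g); [exact: cvg_snd|exact: cg].
  by apply: (@continuousM _ _ fst (fun=> w)); [exact: cvg_fst|exact: cst_continuous].
by apply: continuous_pair; apply: c => q; [exact: cvg_fst|exact: cvg_snd].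
Qed.

(** Two points [mix a x p] and [mix b y p] have a convex combination with weight
    [T] at the apex; the remaining weight [1 - T] is shared by [x] and [y], and can
    be normalised unless [T = 1], when the combination is the apex. *)
Lemma mix_closed_cone p K : mix_closed K -> mix_closed (cone p K).
Proof.
move=> vK _ _ t [[a x] [/= + Kx] <-] [[b y] [/= + Ky] <-] t01.
rewrite !in_itv/= => a01 b01.
pose T := (1 - t) * a + t * b.
have T01 : 0 <= T <= 1 by rewrite /T; nra.
have u0 : 0 <= (1 - t) * (1 - a) by nra.
have v0 : 0 <= t * (1 - b) by nra.
have TE : 1 - T = (1 - t) * (1 - a) + t * (1 - b) by rewrite /T; ring.
have [T1|T1] := eqVneq T 1.
  exists (1, x); first by split; rewrite //= in_itv/= ler01 lexx.
  have u1 : (1 - t) * (1 - a) = 0 by lra.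
  have side1 : t * (1 - b) = 0 by lra.
  have E (c d e : R) :
      (1 - t) * ((1 - a) * c + a * e) + t * ((1 - b) * d + b * e) = e.
    by transitivity ((1 - t) * (1 - a) * c + t * (1 - b) * d + T * e);
      [rewrite /T; ring|rewrite u1 side1 T1; ring].
  by rewrite /mix/= subrr !mul0r !add0r !mul1r !E; case: (p).
have T1' : 1 - T != 0 by rewrite subr_eq0 eq_sym.
have T1gt : 0 < 1 - T by rewrite lt_neqAle eq_sym T1'; lra.
exists (T, mix (t * (1 - b) / (1 - T)) x y).
  split; rewrite /= ?in_itv//; apply: vK => //.
  by rewrite divr_ge0 ?(ltW T1gt)// ler_pdivrMr// mul1r; lra.
have lE : 1 - t * (1 - b) / (1 - T) = (1 - t) * (1 - a) / (1 - T).
  by rewrite -[X in X - _](divff T1') -mulrBl; congr (_ / _); lra.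
have E (c d e : R) :
    (1 - T) * ((1 - t * (1 - b) / (1 - T)) * c + t * (1 - b) / (1 - T) * d) + T * e
    = (1 - t) * ((1 - a) * c + a * e) + t * ((1 - b) * d + b * e).
  transitivity ((1 - t) * (1 - a) * c + t * (1 - b) * d + T * e).
    by rewrite lE; field.
  by rewrite /T; ring.
by rewrite /mix/= !E.
Qed.

Lemma body_cone p K : body K -> body (cone p K).
Proof.
move=> [cK vK]; split; last exact: mix_closed_cone.
apply: continuous_compact; last by apply: compact_setX => //; exact: segment_compact.
apply: continuous_subspaceT.
have c (w : R) (g : R * R -> R) : continuous g ->
    continuous (fun q : R * (R * R) => (1 - q.1) * g q.2 + q.1 * w).
  move=> cg q.
  apply: (@continuousD _ R^o _ (fun q : R * (R * R) => (1 - q.1) * g q.2)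
    (fun q => q.1 * w)).
    apply: (@continuousM _ _ (fun q : R * (R * R) => 1 - q.1) (fun q => g q.2)).
      by apply: (@continuousB _ R^o _ (fun=> 1) fst); [exact: cst_continuous|exact: cvg_fst].
    by apply: (@continuous_comp _ _ _ snd g); [exact: cvg_snd|exact: cg].
  by apply: (@continuousM _ _ fst (fun=> w)); [exact: cvg_fst|exact: cst_continuous].
by apply: continuous_pair; apply: c => q; [exact: cvg_fst|exact: cvg_snd].
Qed.

Lemma sub_sweep v K z t : K z -> 0 <= t <= 1 -> sweep v K (slide t v z).
Proof. by move=> Kz t01; exists (t, z). Qed.

(** Every vertical slice over the projection of [K] becomes longer by one. *)
Lemma area_sweep_vertical K lo hi : body K -> extremes fst K lo hi ->
  area (sweep (0, 1) K) = (area K + (hi.1 - lo.1)%:E)%E.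
Proof.
move=> bK [Klo Khi ext].
have lohi : lo.1 <= hi.1 by have /andP[] := ext _ Khi.
have projK x : xsection K x !=set0 <-> x \in `[lo.1, hi.1].
  split=> [[y /xsectionP /ext]|]; rewrite ?in_itv//= => /andP[lx xh].
  have [E|ne] := eqVneq lo.1 hi.1.
    exists lo.2; apply/xsectionP; have -> : x = lo.1 by apply/le_anti; rewrite lx andbT E xh.
    by case: (lo) Klo.
  have lt : 0 < hi.1 - lo.1 by rewrite subr_gt0 lt_neqAle ne.
  pose t := (x - lo.1) / (hi.1 - lo.1).
  exists (mix t lo hi).2; apply/xsectionP.
  have -> : (x, (mix t lo hi).2) = mix t lo hi.
    by rewrite /mix /t; congr pair; rewrite /=; field; rewrite lt0r_neq0.
  by apply: bK.2 => //; rewrite /t divr_ge0 ?subr_ge0// ler_pdivrMr// mul1r lerD2r.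
have slice x : leb (xsection (sweep (0, 1) K) x) =
    (leb (xsection K x) + (\1_`[lo.1, hi.1] x)%:E)%E.
  have E : xsection (sweep (0, 1) K) x =
      [set y + t | y in xsection K x & t in `[0, 1]%classic].
    apply/seteqP; split=> y.
      move=> /xsectionP[[t z] [/= t01 Kz] [Ex Ey]].
      exists z.2; last by exists t => //; rewrite -Ey /=; ring.
      by apply/xsectionP; rewrite -Ex mulr0 addr0; case: (z) Kz.
    move=> [y' /xsectionP Ky [t t01 <-]]; apply/xsectionP.
    by exists (t, (x, y')) => //; rewrite /slide/=; congr pair; ring.
  rewrite E indicE; have [S0|[l [r [lr S]]]] := body_slice x bK.
    rewrite S0; have -> : (x \in `[lo.1, hi.1]%classic) = false.
      apply/negbTE/negP => /set_mem /= /(projK x).2 [y]; by rewrite S0.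
    rewrite adde0 (_ : [set _ | _ in _ & _ in _] = set0)//.
    by apply/seteqP; split => // y [].
  have -> : (x \in `[lo.1, hi.1]%classic).
    apply/mem_set/(projK x).1; exists l; rewrite S /= in_itv/= lexx//.
  rewrite S (_ : [set _ | _ in _ & _ in _] = `[l, r + 1]%classic).
    by rewrite !lebesgue_segment//= -?EFinD; [congr EFin; ring|lra].
  apply/seteqP; split=> [_ [y + [t + <-]]|y] /=; rewrite ?in_itv/=.
    by rewrite !in_itv/= => yl t01; lra.
  move=> /andP[ly yr]; have [yr'|yr'] := leP y r.
    by exists y; rewrite /= ?in_itv/= ?ly//; exists 0; rewrite /= ?in_itv/= ?lexx ?ler01 ?addr0.
  exists r; rewrite /= ?in_itv/= ?lr ?lexx//; exists (y - r); rewrite /= ?in_itv/=; [lra|ring].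
have mK := body_measurable bK.
rewrite !areaE; under eq_integral do rewrite slice.
rewrite ge0_integralD//.
- by rewrite integral_indic//; congr (_ + _)%E; rewrite setIT; exact: lebesgue_segment.
- exact: measurable_fun_xsection.
- by apply/measurable_EFinP; exact: measurable_indic.
Qed.

(* a unimodular map carrying v to (0, 1) *)
Lemma straighten v : v != (0, 0) -> exists c d,
  lin v.2 (- v.1) c d v = (0, 1) /\ v.2 * d - - v.1 * c = 1.
Proof.
move=> v0; have [E|n0] := eqVneq v.1 0.
  have n1 : v.2 != 0 by apply: contra_neq v0 => E2; rewrite [v]surjective_pairing E E2.
  by exists 0, (v.2)^-1; rewrite /lin; split; [congr pair|]; rewrite /= ?E; field.
by exists (v.1)^-1, 0; rewrite /lin; split; [congr pair|]; rewrite /=; try field.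
Qed.

Lemma lin_slide a b c d t v z :
  lin a b c d (slide t v z) = slide t (lin a b c d v) (lin a b c d z).
Proof. by rewrite /lin /slide/=; congr pair; ring. Qed.

Lemma image_sweep a b c d v K :
  lin a b c d @` sweep v K = sweep (lin a b c d v) (lin a b c d @` K).
Proof.
apply/seteqP; split=> [_ [_ [[t z] [t01 Kz] <-] <-]|_ [[t _] [/= t01 [z Kz <-]] <-]].
  by rewrite lin_slide; exists (t, lin a b c d z) => //; split => //; exists z.
by rewrite /= -lin_slide; exists (slide t v z) => //; exists (t, z).
Qed.

Lemma image_cone a b c d p K :
  lin a b c d @` cone p K = cone (lin a b c d p) (lin a b c d @` K).
Proof.
apply/seteqP; split=> [_ [_ [[t z] [t01 Kz] <-] <-]|_ [[t _] [/= t01 [z Kz <-]] <-]].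
  by rewrite lin_mix; exists (t, lin a b c d z) => //; split => //; exists z.
by rewrite /= -lin_mix; exists (mix t z p) => //; exists (t, z).
Qed.

Lemma extremes_lin v c d K lo hi : extremes (cross v) K lo hi ->
  extremes fst (lin v.2 (- v.1) c d @` K)
    (lin v.2 (- v.1) c d lo) (lin v.2 (- v.1) c d hi).
Proof.
move=> [Klo Khi ext]; split; [by exists lo|by exists hi|].
by move=> _ [z /ext + <-]; rewrite /cross /lin/=; lra.
Qed.

(** A unimodular map that carries [v] to [(0, 1)] carries the functional [cross v]
    to the first coordinate, which reduces the statement to the vertical case. *)
Lemma area_sweep v K lo hi : v != (0, 0) -> body K -> extremes (cross v) K lo hi ->
  area (sweep v K) = (area K + (cross v hi - cross v lo)%:E)%E.
Proof.
move=> /straighten[c [d [Ev det1]]] bK /(extremes_lin c d) ext.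
rewrite -(area_lin det1 (body_sweep v bK)) image_sweep Ev.
rewrite (area_sweep_vertical (body_lin _ _ _ _ bK) ext) area_lin//.
by congr (_ + _%:E)%E; rewrite /cross /lin/=; ring.
Qed.

(** A point of the cone over [K] with apex [p + (0, 1)] lies [t] above the point
    [mix t z p] of [K].  As [z] lies in the strip between [lo] and [hi], the
    abscissa of this point limits [t] by the tent function with top at [p]. *)
Lemma area_cone_vertical p K lo hi : body K -> K p -> extremes fst K lo hi ->
  (area (cone (slide 1 (0, 1) p)%R K) <= area K + ((hi.1 - lo.1) / 2)%:E)%E.
Proof.
move=> bK Kp [Klo Khi ext]; set q := slide 1 (0, 1) p.
have /andP[mc cM] := ext _ Kp.
have mc' := body_measurable (body_cone q bK).
have slice x : (leb (xsection (cone q K) x) <=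
    leb (xsection K x) + (tent lo.1 p.1 hi.1 x)%:E)%E.
  have lift y : xsection (cone q K) x y -> exists y' t,
      [/\ xsection K x y', y = y' + t & 0 <= t <= tent lo.1 p.1 hi.1 x].
    move=> /xsectionP[[t z] [/= t01 Kz] [Ex Ey]].
    move: t01; rewrite in_itv/= => /andP[t0 t1].
    exists (mix t z p).2, t; split.
    - apply/xsectionP; have -> : (x, (mix t z p).2) = mix t z p.
        by rewrite [RHS]surjective_pairing -Ex /=; congr pair; ring.
      by apply: bK.2; rewrite ?t0.
    - by rewrite -Ey /=; ring.
    have singleE : (x \in [set p.1]) = (x == p.1).
      by apply/idP/eqP => [/set_mem|->]; rewrite ?inE.
    rewrite t0 /tent !indicE singleE !mem_setE/= !in_itv/=.
    have /andP[lz zh] := ext _ Kz.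
    have xE : x - p.1 = (1 - t) * (z.1 - p.1) by rewrite -Ex /=; ring.
    have [xc|xc|xc] := ltgtP x p.1.
    - have -> : lo.1 <= x by nra.
      have d0 : 0 < p.1 - lo.1 by nra.
      rewrite /= mulr1 mulr0 !addr0 [X in X - _]mulrC -mulrBl ler_pdivlMr//; nra.
    - have -> : x <= hi.1 by nra.
      have d0 : 0 < hi.1 - p.1 by nra.
      rewrite /= andbF mulr1 mulr0 !add0r mulNr mulrC addrC -mulrBl ler_pdivlMr//; nra.
    - by rewrite andbF !mulr0 add0r addr0.
  have [S0|[l [r [lr S]]]] := body_slice x bK.
    rewrite S0 measure0 add0e (_ : xsection _ _ = set0) ?measure0 ?lee_fin ?tent_ge0//.
    by apply/seteqP; split => // y /lift[y' [t []]]; rewrite S0.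
  apply: (@le_trans _ _ (leb `[l, r + tent lo.1 p.1 hi.1 x]%classic)).
    apply: le_measure; rewrite ?inE//; first exact: measurable_xsection.
    move=> y /lift[y' [t []]]; rewrite S /= !in_itv/=; lra.
  have t0 := tent_ge0 lo.1 p.1 hi.1 x.
  by rewrite S !lebesgue_segment//; [rewrite -EFinD lee_fin|]; lra.
have mK := body_measurable bK.
have mt : measurable_fun setT (EFin \o tent lo.1 p.1 hi.1).
  by apply/measurable_EFinP; exact: measurable_tent.
rewrite !areaE -(integral_tent mc cM) -ge0_integralD//; first last.
- by move=> x _; rewrite lee_fin tent_ge0.
- exact: measurable_fun_xsection.
apply: ge0_le_integral => //.
- exact: measurable_fun_xsection.
- by apply: emeasurable_funD => //; exact: measurable_fun_xsection.
Qed.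
Lemma area_cone v p K lo hi : v != (0, 0) -> body K -> K p ->
    extremes (cross v) K lo hi ->
  (area (cone (slide 1 v p)%R K) <= area K + ((cross v hi - cross v lo) / 2)%:E)%E.
Proof.
move=> /straighten[c [d [Ev det1]]] bK Kp /(extremes_lin c d) ext.
rewrite -(area_lin det1 (body_cone _ bK)) image_cone lin_slide Ev -(area_lin det1 bK).
have Kp' : (lin v.2 (- v.1) c d @` K) (lin v.2 (- v.1) c d p) by exists p.
apply: le_trans (area_cone_vertical (body_lin _ _ _ _ bK) Kp' ext) _.
by rewrite leeD2l// lee_fin /cross /lin/=; lra.
Qed.

End Growth.

(** * Convex hulls *)

Section Hull.
Variable R : realType.
Implicit Types (A K : set (R * R)) (u v p lo hi : R * R).

Lemma convex_setP K : @convex_set R (plane R) K <-> mix_closed K.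
Proof.
have convE (x y : R * R) (l : {i01 R}) : conv l (y : convex_lmodType (plane R)) x = mix l%:num x y.
  by rewrite /conv/= /mix; congr pair; exact: addrC.
split=> [cK x y t Kx Ky /andP[t0 t1]|vK x y l].
  by have := cK y x (Itv01 t0 t1); rewrite convE /= !inE; apply.
by rewrite convE !inE => Kx Ky; apply: vK => //; apply/andP; split.
Qed.

Lemma conv_hull_sub A : A `<=` conv_hull A.
Proof. exact: sub_gen_smallest. Qed.

Lemma conv_hull_min A K : mix_closed K -> A `<=` K -> conv_hull A `<=` K.
Proof. by move=> /convex_setP; exact: smallest_sub. Qed.

Lemma mix_closed_hull A : mix_closed (conv_hull A : set (R * R)).
Proof.
move=> x y t Ax Ay t01 K [cK AK].
by apply: ((convex_setP K).1 cK) => //; [exact: (Ax K (conj cK AK))|exact: (Ay K (conj cK AK))].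
Qed.

Lemma conv_hull_cone p A : A !=set0 ->
  conv_hull ([set p] `|` A) = cone p (conv_hull A).
Proof.
move=> [a Aa]; apply/seteqP; split.
  apply: conv_hull_min; first by apply: mix_closed_cone; exact: mix_closed_hull.
  move=> x [->|Ax].
    exists (1, a); first by split; [rewrite /= in_itv/= ler01 lexx|exact: conv_hull_sub].
    by rewrite [RHS]surjective_pairing; congr pair; rewrite /=; ring.
  exists (0, x); first by split; [rewrite /= in_itv/= ler01 lexx|exact: conv_hull_sub].
  by rewrite [RHS]surjective_pairing; congr pair; rewrite /=; ring.
move=> _ [[t x] [/= t01 Ax] <-]; apply: mix_closed_hull; last first.
- by move: t01; rewrite in_itv.
- by apply: conv_hull_sub; left.
move: x Ax; apply: conv_hull_min => [|x Ax]; first exact: mix_closed_hull.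
by apply: conv_hull_sub; right.
Qed.

Lemma conv_hull1 p : conv_hull [set p] = [set p].
Proof.
apply/seteqP; split; last exact: conv_hull_sub.
apply: conv_hull_min => // x y t -> -> _; rewrite /set1/=.
by rewrite [RHS]surjective_pairing; congr pair; rewrite /=; ring.
Qed.

Lemma cross_mix v t (x y : R * R) :
  cross v (mix t x y) = (1 - t) * cross v x + t * cross v y.
Proof. by rewrite /cross/=; ring. Qed.

Lemma extremes_hull v A lo hi :
  extremes (cross v) A lo hi -> extremes (cross v) (conv_hull A) lo hi.
Proof.
move=> [Alo Ahi ext]; split; do ?exact: conv_hull_sub.
apply: conv_hull_min => // x y t /= hx hy t01; rewrite cross_mix; nra.
Qed.

Lemma cross_slide v t u (x : R * R) :
  cross v (slide t u x) = cross v x + t * cross v u.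
Proof. by rewrite /cross/=; ring. Qed.

Lemma sweep_self v K : K `<=` sweep v K.
Proof.
move=> x Kx; exists (0, x); first by split; rewrite //= in_itv/= lexx ler01.
by rewrite [RHS]surjective_pairing; congr pair; rewrite /=; ring.
Qed.

Lemma sweep_end v K x : K x -> sweep v K (slide 1 v x).
Proof. by move=> Kx; exists (1, x) => //; split; rewrite //= in_itv/= lexx ler01. Qed.

Lemma extremes_sweep_up u v K lo hi : 0 <= cross v u ->
  extremes (cross v) K lo hi -> extremes (cross v) (sweep u K) lo (slide 1 u hi).
Proof.
move=> uv [Klo Khi ext]; split; [exact: sweep_self|exact: sweep_end|].
move=> _ [[t x] [/= + /ext xb] <-]; rewrite in_itv/= !cross_slide => t01; nra.
Qed.

Lemma extremes_sweep_down u v K lo hi : cross v u <= 0 ->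
  extremes (cross v) K lo hi -> extremes (cross v) (sweep u K) (slide 1 u lo) hi.
Proof.
move=> uv [Klo Khi ext]; split; [exact: sweep_end|exact: sweep_self|].
move=> _ [[t x] [/= + /ext xb] <-]; rewrite in_itv/= !cross_slide => t01; nra.
Qed.

End Hull.

(** * The area of the hull of the cells *)

Section Steiner.
Variable R : realType.
Implicit Types (K : set (R * R)) (s : seq (int * int)).

Definition centre (p : int * int) : R * R := (p.1%:~R, p.2%:~R).

Definition centres s : set (R * R) := [set centre p | p in [set` s]].

(** Edge vectors of the hexagon, in cyclic order with every second one omitted.
    Their sum vanishes, so that the zonotope they span from the origin is centred
    there and equals the cell at the origin. *)
Definition side1 : R * R := (- (2 / 3), 1 / 3).
Definition side3 : R * R := (1 / 3, 1 / 3).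
Definition side2 : R * R := (1 / 3, - (2 / 3)).

Definition fatten K := sweep side2 (sweep side3 (sweep side1 K)).

Lemma centres1 p : centres [:: p] = [set centre p].
Proof.
apply/seteqP; split=> [_ [q /= + <-]|_ ->]; first by rewrite inE => /eqP->.
by exists p; rewrite //= inE.
Qed.

Lemma centres_cons p s : centres (p :: s) = [set centre p] `|` centres s.
Proof.
apply/seteqP; split=> [_ [r /= + <-]|_ [->|[r /= rs <-]]].
- by rewrite inE => /predU1P[->|rs]; [left|right; exists r].
- by exists p; rewrite //= mem_head.
- by exists r; rewrite //= inE rs orbT.
Qed.

(** The hull of finitely many points is an iterated cone, hence compact. *)
Lemma body_centres s : s != [::] -> body (conv_hull (centres s)).
Proof.
case: s => // p s _; elim: s p => [|q s IH] p.
  rewrite centres1 conv_hull1; split; first exact: compact_set1.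
  by rewrite -conv_hull1; exact: mix_closed_hull.
rewrite centres_cons conv_hull_cone; first exact/body_cone/IH.
by exists (centre q), q => //=; rewrite mem_head.
Qed.

Lemma fatten_centre K (t1 t2 t3 : R) x : K x ->
    0 <= t1 <= 1 -> 0 <= t2 <= 1 -> 0 <= t3 <= 1 ->
  fatten K (slide t3 side2 (slide t2 side3 (slide t1 side1 x))).
Proof. by move=> Kx h1 h2 h3; do 3 apply: sub_sweep => //. Qed.

Lemma cross_side1 p : cross side1 (centre p) = (normal1 p)%:~R / 3.
Proof. by rewrite /cross /normal1/= !rmorphD/=; field. Qed.

Lemma cross_side3 p : cross side3 (centre p) = (normal3 p)%:~R / 3.
Proof. by rewrite /cross /normal3/= rmorphB/=; field. Qed.

Lemma cross_side2 p : cross side2 (centre p) = - (normal2 p)%:~R / 3.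
Proof. by rewrite /cross /normal2/= !rmorphD/=; field. Qed.

Definition spans (f : int * int -> int) s lo hi :=
  [/\ lo \in s, hi \in s & forall p, p \in s -> f lo <= f p <= f hi].

(** [area_sweep] three times.  After the first sweep the extreme points for the
    following directions move along the swept segments; these displacements
    contribute the term 1, the area of a cell. *)
Lemma area_fatten s x1 y1 x2 y2 x3 y3 : s != [::] ->
  spans normal1 s y1 x1 -> spans normal2 s y2 x2 -> spans normal3 s y3 x3 ->
  area (fatten (conv_hull (centres s))) =
    (area (conv_hull (centres s)) + ((spread x1 y1 x2 y2 x3 y3)%:~R / 3 + 1)%:E)%E.
Proof.
move=> s0 [y1s x1s e1] [y2s x2s e2] [y3s x3s e3]; have bK := body_centres s0.
have inC p : p \in s -> centres s (centre p) by exists p.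
have E1 : extremes (cross side1) (centres s) (centre y1) (centre x1).
  split; try exact: inC; move=> _ [p /= /e1 + <-]; rewrite !cross_side1.
  by rewrite !ler_pM2r ?invr_gt0// !ler_int.
have E2 : extremes (cross side3) (centres s) (centre y3) (centre x3).
  split; try exact: inC; move=> _ [p /= /e3 + <-]; rewrite !cross_side3.
  by rewrite !ler_pM2r ?invr_gt0// !ler_int.
have E3 : extremes (cross side2) (centres s) (centre x2) (centre y2).
  split; try exact: inC; move=> _ [p /= /e2 + <-]; rewrite !cross_side2.
  by rewrite !ler_pM2r ?invr_gt0// !lerN2 !ler_int andbC.
move: E1 E2 E3 => /extremes_hull E1 /extremes_hull E2 /extremes_hull E3.
have n1 : side1 != (0, 0) by apply/eqP => -[]; lra.
have n2 : side3 != (0, 0) by apply/eqP => -[]; lra.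
have n3 : side2 != (0, 0) by apply/eqP => -[]; lra.
have c21 : cross side3 side1 = - (1 / 3) by rewrite /cross/=; field.
have c31 : cross side2 side1 = 1 / 3 by rewrite /cross/=; field.
have c32 : cross side2 side3 = - (1 / 3) by rewrite /cross/=; field.
have {}E2 := @extremes_sweep_down _ side1 _ _ _ _ _ E2.
have {}E3 := @extremes_sweep_up _ side1 _ _ _ _ _ E3.
have {}E3 := @extremes_sweep_down _ side3 _ _ _ _ _ (E3 _).
rewrite /fatten (area_sweep n3 (body_sweep _ (body_sweep _ bK)) (E3 _ _)); [|lra..].
rewrite (area_sweep n2 (body_sweep _ bK) (E2 _)); [|lra].
rewrite (area_sweep n1 bK E1); move: (area _) => a.
rewrite -!addeA -!EFinD; congr (_ + _%:E)%E.
rewrite !cross_slide !cross_side1 !cross_side3 !cross_side2 c21 c31 c32.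
by rewrite /spread !(rmorphD, rmorphN)/=; field.
Qed.
End Steiner.
Arguments centres R s : clear implicits.

Section Cells.
Variable R : realType.
Implicit Types (K : set (R * R)) (s : seq (int * int)).

Definition axial : R * R -> R * R :=
  lin (kappa R) (kappa R / 2) 0 (kappa R * (Num.sqrt 3 / 2)).

Lemma axialE (q r : R) : of_axial q r = axial (q, r).
Proof. by rewrite /of_axial /axial /lin/=; congr pair; ring. Qed.

Lemma sqrt3_gt0 : 0 < Num.sqrt 3 :> R.
Proof. by rewrite sqrtr_gt0. Qed.

Lemma axial_det : kappa R * (kappa R * (Num.sqrt 3 / 2)) - kappa R / 2 * 0 = 1.
Proof.
have s3 := sqrt3_gt0.
have k2 : kappa R ^+ 2 = 2 / Num.sqrt 3 by rewrite sqr_sqrtr// divr_ge0// ltW.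
transitivity (kappa R ^+ 2 * (Num.sqrt 3 / 2)); first by ring.
by rewrite k2; field; rewrite gt_eqF.
Qed.

Definition corner (p : int * int) (t1 t2 t3 : R) : R * R :=
  slide t3 (side2 R) (slide t2 (side3 R) (slide t1 (side1 R) (centre R p))).

Lemma vertex_corner p (k : 'I_6) :
  let t := nth (0, 0, 0)
    [:: (0, 1, 0); (1, 1, 0); (1, 0, 0); (1, 0, 1); (0, 0, 1); (0, 1, 1)] k in
  vertex R p k = axial (corner p t.1.1 t.1.2 t.2).
Proof.
rewrite /vertex axialE /corner /slide /centre.
by case: k => -[|[|[|[|[|[|//]]]]]] ? /=; congr axial; congr pair; field.
Qed.

(** A cell contains all points of the zonotope since it contains the images of the
    eight vertices of the parameter cube: six of these are the vertices of the
    hexagon, the other two are its centre. *)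
Lemma cell_corner p t1 t2 t3 : 0 <= t1 <= 1 -> 0 <= t2 <= 1 -> 0 <= t3 <= 1 ->
  cell R p (axial (corner p t1 t2 t3)).
Proof.
have mixE (v x : R * R) t : slide t v x = mix t x (slide 1 v x).
  by rewrite /slide /mix/=; congr pair; ring.
have V (k : 'I_6) t1' t2' t3' : (t1', t2', t3') = nth (0, 0, 0)
    [:: (0, 1, 0); (1, 1, 0); (1, 0, 0); (1, 0, 1); (0, 0, 1); (0, 1, 1)] k ->
    cell R p (axial (corner p t1' t2' t3')).
  move=> E; apply: conv_hull_sub; exists k => //.
  by rewrite vertex_corner -E.
have M (x y z : R * R) t : 0 <= t <= 1 -> z = mix t x y ->
    cell R p (axial x) -> cell R p (axial y) -> cell R p (axial z).
  by move=> t01 -> cx cy; rewrite /axial lin_mix; exact: mix_closed_hull.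
have V000 : cell R p (axial (corner p 0 0 0)).
  apply: (M (corner p 0 1 0) (corner p 1 0 1) _ (1 / 2)).
  - lra.
  - by rewrite /corner /slide /mix/=; congr pair; field.
  - exact: (V (@Ordinal 6 0 isT)).
  - exact: (V (@Ordinal 6 3 isT)).
have V111 : cell R p (axial (corner p 1 1 1)).
  have -> // : corner p 1 1 1 = corner p 0 0 0.
  by rewrite /corner /slide /=; congr pair; field.
move=> h1 h2 h3.
have M1 b2 b3 : cell R p (axial (corner p 0 b2 b3)) ->
    cell R p (axial (corner p 1 b2 b3)) -> cell R p (axial (corner p t1 b2 b3)).
  by apply: M h1 _; rewrite /corner /slide /mix/=; congr pair; ring.
have M2 b3 : cell R p (axial (corner p t1 0 b3)) ->
    cell R p (axial (corner p t1 1 b3)) -> cell R p (axial (corner p t1 t2 b3)).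
  by apply: M h2 _; rewrite /corner /slide /mix/=; congr pair; ring.
have M3 : cell R p (axial (corner p t1 t2 0)) ->
    cell R p (axial (corner p t1 t2 1)) -> cell R p (axial (corner p t1 t2 t3)).
  by apply: M h3 _; rewrite /corner /slide /mix/=; congr pair; ring.
apply: M3; apply: M2; apply: M1 => //.
- exact: (V (@Ordinal 6 2 isT)).
- exact: (V (@Ordinal 6 0 isT)).
- exact: (V (@Ordinal 6 1 isT)).
- exact: (V (@Ordinal 6 4 isT)).
- exact: (V (@Ordinal 6 3 isT)).
- exact: (V (@Ordinal 6 5 isT)).
Qed.

Lemma mix_closed_fatten K : mix_closed K -> mix_closed (fatten K).
Proof. by move=> ?; do 3 apply: mix_closed_sweep. Qed.

Lemma body_fatten K : body K -> body (fatten K).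
Proof. by move=> ?; do 3 apply: body_sweep. Qed.

(** For the inclusion from right to left: the points whose translates by every
    point of the zonotope lie in the hull of the cells form a convex set that
    contains the centres. *)
Lemma hull_cells s : conv_hull (\bigcup_(p in [set` s]) cell R p) =
  axial @` fatten (conv_hull (centres R s)).
Proof.
apply/seteqP; split.
  have cI : mix_closed (axial @` fatten (conv_hull (centres R s))).
    by apply: mix_closed_lin; apply: mix_closed_fatten; exact: mix_closed_hull.
  apply: conv_hull_min => // x [p ps]; apply: conv_hull_min => // _ [k _ <-].
  rewrite vertex_corner; eexists; last by [].
  apply: fatten_centre; first (by apply: conv_hull_sub; exists p);
    by case: k => -[|[|[|[|[|[|//]]]]]] ? /=; rewrite ?lexx ?ler01.
move=> _ [_ [[t3 _] [/= h3 [[t2 _] [/= h2 [[t1 x] [/= h1 Kx] <-]] <-]] <-] <-].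
rewrite in_itv/= in h1; rewrite in_itv/= in h2; rewrite in_itv/= in h3.
move: x Kx; apply: conv_hull_min => [x y t Hx Hy t01|_ [p ps <-]] /=.
  have E u (v x' y' : R * R) : slide u v (mix t x' y') = mix t (slide u v x') (slide u v y').
    by rewrite /slide /mix/=; congr pair; ring.
  by rewrite !E /axial lin_mix; exact: mix_closed_hull.
by apply: conv_hull_sub; exists p => //; exact: cell_corner.
Qed.

Lemma area_hull_cells s : s != [::] ->
  area (conv_hull (\bigcup_(p in [set` s]) cell R p)) =
  area (fatten (conv_hull (centres R s))).
Proof.
move=> s0; rewrite hull_cells area_lin//; first exact: axial_det.
by apply: body_fatten; exact: body_centres.
Qed.
End Cells.

(** * Adjacency, and polyhexes as growing trees *)

Section Adjacency.
Variable R : realType.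
Implicit Types (p q : int * int) (k l : 'I_6).

(** The sum of the two vertices of the edge with index [k] is the centre of the
    cell plus that of its neighbour across this edge, which is in direction [k]. *)
Definition directions : seq (int * int) :=
  [:: (0, 1); (-1, 1); (-1, 0); (0, -1); (1, -1); (1, 0)].

Lemma edge_sum p k :
  let m := centre R (p + p + nth 0 directions k) in
  (vertex R p k).1 + (vertex R p (ordS k)).1 = (axial m).1 /\
  (vertex R p k).2 + (vertex R p (ordS k)).2 = (axial m).2.
Proof.
rewrite /vertex !axialE /axial /lin /centre.
by case: k => -[|[|[|[|[|[|//]]]]]] ? /=; rewrite !rmorphD/=; split; field.
Qed.

(** The extreme values of [f] on a segment are its values at the endpoints, hence
    determined by the segment up to their order. *)
Lemma segment_sum (f : R * R -> R) (a b c d : R * R) :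
    (forall t x y, f (mix t x y) = (1 - t) * f x + t * f y) ->
  conv_hull [set a; b] = conv_hull [set c; d] -> f a + f b = f c + f d.
Proof.
move=> fmix E.
have bounds (x y z : R * R) : conv_hull [set x; y] z ->
    Num.min (f x) (f y) <= f z <= Num.max (f x) (f y).
  move: z; apply: (@conv_hull_min R _ [set z | _ <= f z <= _]).
    by move=> u v t /=; rewrite fmix; move: (Num.min _ _) (Num.max _ _) => m M; nra.
  by move=> _ [->|->] /=; rewrite !ge_min !le_max !lexx ?orbT.
have in1 (x y : R * R) : conv_hull [set x; y] x by apply: conv_hull_sub; left.
have in2 (x y : R * R) : conv_hull [set x; y] y by apply: conv_hull_sub; right.
have := in1 a b; rewrite E => /bounds; have := in2 a b; rewrite E => /bounds.
have := in1 c d; rewrite -E => /bounds; have := in2 c d; rewrite -E => /bounds.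
rewrite !minEle !maxEle; case: (leP (f a) (f b)); case: (leP (f c) (f d)); lra.
Qed.

(** Comparing the sums of the endpoints of the common edge gives
    [2 p + d_k = 2 q + d_l] for two directions [d_k] and [d_l].  By parity these are
    equal or opposite, and they are not equal since [p] and [q] are distinct. *)
Lemma adjacent_directions p q : adjacent_cells R p q ->
  exists k, p = q + nth 0 directions k.
Proof.
move=> [pq [k [l E]]].
have E1 := segment_sum (f := fst) (fun _ _ _ => erefl) E.
have E2 := segment_sum (f := snd) (fun _ _ _ => erefl) E.
have [P1 P2] := edge_sum p k; have [Q1 Q2] := edge_sum q l.
rewrite {}P1 {}Q1 in E1; rewrite {}P2 {}Q2 in E2.
have k0 : kappa R != 0.
  by apply: contra_eq_neq (axial_det R) => ->; rewrite !mul0r subrr eq_sym oner_eq0.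
have s0 : Num.sqrt 3 / 2 != 0 :> R by rewrite mulf_neq0 ?gt_eqF ?sqrt3_gt0.
move: E1 E2; rewrite /axial /lin /= !mul0r !add0r.
move=> E1 /(mulfI (mulf_neq0 k0 s0)) /intr_inj E2; move: E1; rewrite E2.
move=> /addIr /(mulfI k0) /intr_inj E1.
exists l; case: p q pq E1 E2 {E} => [a b] [a' b'] pq.
case: k => -[|[|[|[|[|[|//]]]]]] ?; case: l => -[|[|[|[|[|[|//]]]]]] ? /= E1 E2.
all: have ne : ~~ ((a == a') && (b == b')) by rewrite -xpair_eqE; exact/eqP.
all: by congr pair; rewrite /=; move: ne E1 E2; clear; lia.
Qed.

Definition step (p q : int * int) := exists2 e : int, e \in [:: 1; -1] &
  [\/ q = (p.1 + e, p.2), q = (p.1, p.2 + e) | q = (p.1 + e, p.2 - e)].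

Lemma adjacent_sym p q : adjacent_cells R p q -> adjacent_cells R q p.
Proof. by move=> [pq [k [l E]]]; split; [exact: nesym|exists l, k]. Qed.

Lemma adjacent_step p q : adjacent_cells R p q -> step p q.
Proof.
move=> /adjacent_sym/adjacent_directions[k ->]; rewrite /step.
case: k => -[|[|[|[|[|[|//]]]]]] ? /=.
- by exists 1 => //; apply: Or32; congr pair; rewrite /= addr0.
- by exists (-1) => //; apply: Or33; congr pair; rewrite /= opprK.
- by exists (-1) => //; apply: Or31; congr pair; rewrite /= addr0.
- by exists (-1) => //; apply: Or32; congr pair; rewrite /= addr0.
- by exists 1 => //; apply: Or33; congr pair.
- by exists 1 => //; apply: Or31; congr pair; rewrite /= addr0.
Qed.

Lemma grown_step a b c (s : seq (int * int)) p q : grown a b c s -> p \in s ->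
  step p q -> exists a' b' c', [/\ grown a' b' c' (q :: s) & (a' + b' + c')%N = (a + b + c).+1].
Proof.
move=> g ps [e es [->|->|->]].
- by exists a.+1, b, c; split; [exact: grownA|lia].
- by exists a, b.+1, c; split; [exact: grownB|lia].
- by exists a, b, c.+1; split; [exact: grownC|lia].
Qed.

(** As long as some cell is missing from the list, a path of cells that leads to it
    has a first cell outside the list, which is a new leaf. *)
Lemma connected_grown (P : {fset int * int}) n : (0 < n)%N -> polyhex R n P ->
  exists a b c s, [/\ grown a b c s, s =i P & (a + b + c)%N = n.-1].
Proof.
move=> n0 [Pn conn].
have [r rP] : exists r, r \in P by apply/fset0Pn; rewrite -cardfs_gt0 Pn.
have grow m : (m < n)%N -> exists a b c s,
    [/\ grown a b c s, uniq s, {subset s <= P}, size s = m.+1 & (a + b + c)%N = m].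
  elim: m => [_|m IH mn].
    exists 0%N, 0%N, 0%N, [:: r]; split=> //; first exact: grown1.
    by move=> x; rewrite inE => /eqP->.
  have [a [b [c [s [g us sP sz abc]]]]] := IH (ltnW mn).
  have [y yP ys] : exists2 y, y \in P & y \notin s.
    apply/hasP; apply: contraTT mn; rewrite -all_predC -leqNgt => /allP sub.
    rewrite -sz -Pn; apply: uniq_leq_size; first exact: fset_uniq.
    by move=> z /sub /=; rewrite negbK.
  have [x xs] : exists x, x \in s by case: (s) sz => // x s' _; exists x; rewrite mem_head.
  have /connectP[w] := conn [` sP _ xs]%fset [` yP]%fset.
  have : val [` sP _ xs]%fset \in s by [].
  have : val [` yP]%fset \notin s by [].
  move: [` yP]%fset [` sP _ xs]%fset => {y yP ys} y {xs}x.
  elim: w x => [|z w IHw] x ys xs /=; first by move=> _ E; rewrite E xs in ys.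
  move=> /andP[/asboolP xz wP] lw; have [zs|zs] := boolP (val z \in s).
    exact: IHw wP lw.
  have [a' [b' [c' [g' abc']]]] := grown_step g xs (adjacent_step xz).
  exists a', b', c', (val z :: s); split; rewrite /= ?zs ?sz ?abc' ?abc//.
  by move=> u; rewrite inE => /predU1P[->|/sP//]; exact: valP.
have n1 : (n.-1 < n)%N by rewrite prednK.
have [a [b [c [s [g us sP sz abc]]]]] := grow _ n1.
exists a, b, c, s; split=> //; apply: (uniq_min_size us sP _).2.
by rewrite sz prednK// -Pn.
Qed.
End Adjacency.

(** * The upper bound *)

Section Upper.
Variable R : realType.

Lemma exists_extremes (T : eqType) (D : realDomainType) (f : T -> D) s :
  s != [::] -> exists lo hi,
  [/\ lo \in s, hi \in s & forall p, p \in s -> f lo <= f p <= f hi].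
Proof.
have max (g : T -> D) : s != [::] ->
    exists2 hi, hi \in s & forall p, p \in s -> g p <= g hi.
  case: s => // p s _; elim: s p => [|q s IH] p.
    by exists p; rewrite ?mem_head// => r; rewrite inE => /eqP->.
  have [hi his ext] := IH q; have [ph|/ltW hp] := leP (g p) (g hi).
    by exists hi => [|r]; rewrite in_cons ?his ?orbT// => /predU1P[->|/ext].
  exists p; rewrite ?mem_head// => r; rewrite inE => /predU1P[->//|/ext rh].
  exact: le_trans rh hp.
move=> s0; have [hi his hiP] := max f s0; have [lo los loP] := max (-%R \o f) s0.
exists lo, hi; split=> // p ps; rewrite hiP// andbT.
by have := loP _ ps; rewrite /= lerN2.
Qed.

Lemma area_set1 (x : R * R) : area [set x] = 0%E.
Proof.
have -> : [set x] = [set x.1] `*` [set x.2].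
  by apply/seteqP; split=> [_ -> //|[a b] [/= -> ->]]; rewrite -surjective_pairing.
rewrite /area product_measure1E//; apply/eqP; rewrite mule_eq0; apply/orP; left.
by apply/eqP; exact: lebesgue_measure_set1.
Qed.

Lemma area_add_centre (s : seq (int * int)) p q v w : s != [::] -> p \in s ->
    v != (0, 0) -> centre R q = slide 1 v (centre R p) ->
    (forall x y, x \in s -> y \in s ->
      cross v (centre R x) - cross v (centre R y) <= w) ->
  (area (conv_hull (centres R (q :: s))) <=
   area (conv_hull (centres R s)) + (w / 2)%:E)%E.
Proof.
move=> s0 ps v0 qE W; have bK := body_centres R s0.
have [lo [hi [los his ext]]] := exists_extremes (fun x => cross v (centre R x)) s0.
have inC x : x \in s -> centres R s (centre R x) by exists x.
have E : extremes (cross v) (conv_hull (centres R s)) (centre R lo) (centre R hi).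
  by apply: extremes_hull; split; try exact: inC; move=> _ [x /= /ext + <-].
rewrite centres_cons conv_hull_cone; last by exists (centre R p); exact: inC.
rewrite qE; apply: le_trans (area_cone v0 bK _ E) _.
  by apply: conv_hull_sub; exact: inC.
by rewrite leeD2l// lee_fin ler_pM2r ?invr_gt0// W.
Qed.

Lemma grown_range_real a b c s (x y : int * int) : grown a b c s ->
  x \in s -> y \in s ->
  [/\ x.2%:~R - y.2%:~R <= (b + c)%:R :> R, x.1%:~R - y.1%:~R <= (a + c)%:R :> R &
      x.1%:~R + x.2%:~R - (y.1%:~R + y.2%:~R) <= (a + b)%:R :> R].
Proof.
move=> g xs ys; have [h1 h2 h3] := grown_range g xs ys.
by split; rewrite -?rmorphD -rmorphB /= -[leRHS]/((_ : nat)%:Z%:~R) ler_int.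
Qed.

(** A leaf of the first kind adds at most [b + c] to twice the area, and
    [a b + b c + c a] increases by just that; similarly for the other kinds. *)
Lemma area_grown a b c s : grown a b c s ->
  (area (conv_hull (centres R s)) <= ((a * b + b * c + c * a)%:R / 2)%:E)%E.
Proof.
have add a' b' c' s' p q (v : R * R) (d m m' : nat) : grown a' b' c' s' -> p \in s' ->
    v != (0, 0) -> centre R q = slide 1 v (centre R p) ->
    (area (conv_hull (centres R s')) <= (m%:R / 2)%:E)%E -> m' = (m + d)%N ->
    (forall x y, x \in s' -> y \in s' ->
      cross v (centre R x) - cross v (centre R y) <= d%:R) ->
    (area (conv_hull (centres R (q :: s'))) <= (m'%:R / 2)%:E)%E.
  move=> g ps v0 qE IH -> W; have s0 : s' != [::] by case: (g).
  apply: le_trans (area_add_centre s0 ps v0 qE W) _.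
  by rewrite natrD mulrDl EFinD leeD2r.
elim=> {a b c s} [p|a b c s p e g IH ps es|a b c s p e g IH ps es|a b c s p e g IH ps es].
  by rewrite centres1 conv_hull1 area_set1 lee_fin.
all: have e1 : e = 1 \/ e = -1 by move: es; rewrite !inE => /orP[] /eqP ->; [left|right].
- apply: (add _ _ _ _ _ _ (e%:~R, 0) (b + c)%N _ _ g ps _ _ IH).
  + by apply/eqP => -[]; case: e1 => ->; rewrite ?rmorphN/=; lra.
  + by rewrite /centre /slide/= rmorphD/=; congr pair; ring.
  + by lia.
  + move=> x y xs ys; have [h _ _] := grown_range_real g xs ys.
    have [h' _ _] := grown_range_real g ys xs; rewrite /cross/=.
    by case: e1 => ->; rewrite ?rmorphN /=; lra.
- apply: (add _ _ _ _ _ _ (0, e%:~R) (a + c)%N _ _ g ps _ _ IH).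
  + by apply/eqP => -[]; case: e1 => ->; rewrite ?rmorphN/=; lra.
  + by rewrite /centre /slide/= rmorphD/=; congr pair; ring.
  + by lia.
  + move=> x y xs ys; have [_ h _] := grown_range_real g xs ys.
    have [_ h' _] := grown_range_real g ys xs; rewrite /cross/=.
    by case: e1 => ->; rewrite ?rmorphN /=; lra.
- apply: (add _ _ _ _ _ _ (e%:~R, - e%:~R) (a + b)%N _ _ g ps _ _ IH).
  + by apply/eqP => -[]; case: e1 => ->; rewrite ?rmorphN/=; lra.
  + by rewrite /centre /slide/= rmorphD rmorphB/=; congr pair; ring.
  + by lia.
  + move=> x y xs ys; have [_ _ h] := grown_range_real g xs ys.
    have [_ _ h'] := grown_range_real g ys xs; rewrite /cross/=.
    by case: e1 => ->; rewrite ?rmorphN /=; lra.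
Qed.

Lemma hull_area_cells (P : {fset int * int}) (s : seq (int * int)) : s =i P ->
  hull_area R P = area (conv_hull (\bigcup_(p in [set` s]) cell R p)).
Proof.
move=> sP; rewrite /hull_area (_ : [set` P] = [set` s])//.
by apply/seteqP; split=> p /=; rewrite sP.
Qed.

(** The integer [m] is the value of six times the area formula for the estimates of
    [area_grown] and [spread_boundP]; being integral, it cannot exceed the ceiling
    of [n^2 + 14 n / 3]. *)
Lemma hull_area_bound (P : {fset int * int}) n : (0 < n)%N -> polyhex R n P ->
  exists2 m : int, 3 * m <= 3 * n%:Z ^+ 2 + 14 * n%:Z + 2 &
  (hull_area R P <= (1 / 6 * m%:~R)%:E)%E.
Proof.
move=> n0 /(connected_grown n0)[a [b [c [s [g sP abc]]]]].
have s0 : s != [::] by case: (g).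
have [y1 [x1 sp1]] := exists_extremes normal1 s0.
have [y2 [x2 sp2]] := exists_extremes normal2 s0.
have [y3 [x3 sp3]] := exists_extremes normal3 s0.
have [y1s x1s _] := sp1; have [y2s x2s _] := sp2; have [y3s x3s _] := sp3.
rewrite (hull_area_cells sP) area_hull_cells// (area_fatten _ s0 sp1 sp2 sp3).
have [bnd _ _ _] := spread_boundP g (And3 x1s x2s x3s) (And3 y1s y2s y3s).
set S := spread _ _ _ _ _ _ in bnd *.
pose m := maxn a (maxn b c).
have Sb : S <= 3 * (a + b + c)%:Z + m%:Z by apply: bnd; rewrite /m; lia.
have mE : m \in [:: a; b; c].
  by rewrite /m !inE; lia.
have arith : 9 * (a * b + b * c + c * a)%:Z + 6 * m%:Z <=
    3 * (a + b + c)%:Z ^+ 2 + 2 * (a + b + c)%:Z + 1.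
  by apply: extremal_arith => //; rewrite /m; lia.
exists (3 * (a * b + b * c + c * a)%:Z + 2 * S + 6).
  have -> : n%:Z = (a + b + c)%:Z + 1 by move: abc n0; clear; lia.
  move: arith Sb; move: (a * b + b * c + c * a)%N (a + b + c)%N => E t; nia.
apply: le_trans (leeD (area_grown g) (lexx _)) _.
move: (a * b + b * c + c * a)%N => E; rewrite -EFinD lee_fin.
have -> : (3 * E%:Z + 2 * S + 6)%:~R = 3 * E%:R + 2 * S%:~R + 6 :> R.
  by rewrite 2!rmorphD 2!rmorphM.
lra.
Qed.
End Upper.

(** * The extremal polyhexes *)

Section Extremal.
Variable R : realType.
Variables (j k b : nat).

(** The path that leads from [(-j, 0)] to [(k, 0)], then to [(k, b)] and finally to
    [(0, b + k)], written with truncated subtraction. *)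
Definition horseshoe (i : nat) : int * int :=
  ((minn i (j + k))%:Z - j%:Z - (i - (j + k + b))%N%:Z, (i - (j + k))%N%:Z).

Definition horseshoe_cells : seq (int * int) := mkseq horseshoe (j + k + b + k).+1.

Definition horseshoe_polyhex : {fset int * int} := seq_fset tt horseshoe_cells.

Lemma horseshoe_inj : injective horseshoe.
Proof. by move=> i i' [/eqP h1 /eqP h2]; lia. Qed.

Lemma mem_horseshoe i : (i <= j + k + b + k)%N -> horseshoe i \in horseshoe_cells.
Proof. by move=> h; apply/mapP; exists i => //; rewrite mem_iota. Qed.

Lemma adjacent_share p q (u v : 'I_6) : p <> q ->
  vertex R p u = vertex R q (ordS v) -> vertex R p (ordS u) = vertex R q v ->
  adjacent_cells R p q.
Proof. by move=> pq E1 E2; split=> //; exists u, v; rewrite /edge E1 E2 setUC. Qed.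

Lemma adjacent_right p : adjacent_cells R p (p.1 + 1, p.2).
Proof.
apply: (@adjacent_share _ _ (@Ordinal 6 5 isT) (@Ordinal 6 2 isT)).
  by move/(congr1 fst) => /=; lia.
all: by rewrite /vertex /=; congr of_axial; rewrite ?rmorphD/=; field.
Qed.

Lemma adjacent_up p : adjacent_cells R p (p.1, p.2 + 1).
Proof.
apply: (@adjacent_share _ _ (@Ordinal 6 0 isT) (@Ordinal 6 3 isT)).
  by move/(congr1 snd) => /=; lia.
all: by rewrite /vertex /=; congr of_axial; rewrite ?rmorphD/=; field.
Qed.

Lemma adjacent_left_up p : adjacent_cells R p (p.1 - 1, p.2 + 1).
Proof.
apply: (@adjacent_share _ _ (@Ordinal 6 1 isT) (@Ordinal 6 4 isT)).
  by move/(congr1 snd) => /=; lia.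
all: by rewrite /vertex /=; congr of_axial; rewrite ?rmorphD/=; field.
Qed.

Lemma adjacent_horseshoe i : adjacent_cells R (horseshoe i) (horseshoe i.+1).
Proof.
have [h|h] := ltnP i (j + k).
  have -> : horseshoe i.+1 = ((horseshoe i).1 + 1, (horseshoe i).2).
    by rewrite /horseshoe /=; congr pair; lia.
  exact: adjacent_right.
have [h'|h'] := ltnP i (j + k + b).
  have -> : horseshoe i.+1 = ((horseshoe i).1, (horseshoe i).2 + 1).
    by rewrite /horseshoe /=; congr pair; lia.
  exact: adjacent_up.
have -> : horseshoe i.+1 = ((horseshoe i).1 - 1, (horseshoe i).2 + 1).
  by rewrite /horseshoe /=; congr pair; lia.
exact: adjacent_left_up.
Qed.

Lemma polyhex_horseshoe : polyhex R (j + k + b + k).+1 horseshoe_polyhex.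
Proof.
have memP p : (p \in horseshoe_polyhex) = (p \in horseshoe_cells) by rewrite seq_fsetE.
split.
  by rewrite size_seq_fset undup_id ?size_mkseq// map_inj_uniq ?iota_uniq//; exact: horseshoe_inj.
rewrite /edge_connected; set e : rel horseshoe_polyhex := (fun x y => `[< _ >]).
have symE : connect_sym e.
  apply: sym_connect_sym => x y; rewrite /e /=.
  by apply/asboolP/asboolP; exact: adjacent_sym.
have root : horseshoe 0 \in horseshoe_polyhex by rewrite memP mem_horseshoe.
suff toroot : forall x, connect e [` root]%fset x.
  by move=> p q; apply: connect_trans (toroot q); rewrite symE.
move=> [x xP]; have : x \in horseshoe_cells by rewrite -memP.
case/mapP => i; rewrite mem_iota /= add0n => iN xE; move: iN x xE xP.
elim: i => [_|i IH iN] x -> xP.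
  by rewrite (_ : [` xP]%fset = [` root]%fset)//; exact: val_inj.
have iP : horseshoe i \in horseshoe_polyhex by rewrite memP mem_horseshoe// ltnW.
apply: connect_trans (IH (ltnW iN) _ erefl iP) _; apply: connect1.
by rewrite /e; apply/asboolP; exact: adjacent_horseshoe.
Qed.

(** The first functional is monotone along the path; the second is greatest at the
    second corner, the third at the first corner. *)
Lemma horseshoe_width : (j <= b + k)%N -> exists x1 y1 x2 y2 x3 y3,
  [/\ spans normal1 horseshoe_cells y1 x1, spans normal2 horseshoe_cells y2 x2,
      spans normal3 horseshoe_cells y3 x3 &
      spread x1 y1 x2 y2 x3 y3 = (4 * b + 6 * k + 3 * j)%N%:Z].
Proof.
move=> jb; pose l := (j + k + b + k)%N.
exists (horseshoe l), (horseshoe 0), (horseshoe (j + k + b)), (horseshoe 0),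
  (horseshoe (j + k)), (horseshoe l).
have mem i : (i <= l)%N -> horseshoe i \in horseshoe_cells by exact: mem_horseshoe.
have spansP f u v : (u <= l)%N -> (v <= l)%N ->
    (forall i, (i <= l)%N -> f (horseshoe u) <= f (horseshoe i) <= f (horseshoe v)) ->
    spans f horseshoe_cells (horseshoe u) (horseshoe v).
  move=> ul vl H; split; [exact: mem|exact: mem|].
  by move=> p /mapP[i]; rewrite mem_iota /= add0n => iN ->; exact: H.
split.
- by apply: spansP => [||i]; rewrite /l /normal1 /horseshoe/=; lia.
- by apply: spansP => [||i]; rewrite /l /normal2 /horseshoe/=; lia.
- by apply: spansP => [||i]; rewrite /l /normal3 /horseshoe/=; lia.
- by rewrite /spread /normal1 /normal2 /normal3 /horseshoe /l/=; lia.
Qed.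

Lemma mix_closed_vertical (K : set (R * R)) (x h y : R) : mix_closed K ->
  K (x, 0) -> K (x, h) -> 0 <= y <= h -> K (x, y).
Proof.
move=> vK K0 Kh /andP[y0 yh].
have [h0|h0] := eqVneq h 0.
  by have -> : y = 0 by apply/le_anti; rewrite y0 -h0 yh.
have hp : 0 < h by rewrite lt_neqAle eq_sym h0 (le_trans y0).
have -> : (x, y) = mix (y / h) (x, 0) (x, h) by rewrite /mix/=; congr pair; field.
by apply: vK => //; rewrite divr_ge0 ?(ltW hp)// ler_pdivrMr// mul1r.
Qed.

(** Over [[0, k]] the hull of the four corners has vertical slices from 0 to
    [b + k - x]; if [j = 1] there is a triangle over [[-1, 0]] in addition. *)
Lemma horseshoe_area : (j <= 1)%N ->
  (((2 * k * b + k * k + j * (b + k))%N%:R / 2)%:E <=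
   area (conv_hull (centres R horseshoe_cells)))%E.
Proof.
move=> j1; set K := conv_hull _.
have bK : body K by exact: body_centres.
have vK : mix_closed K by case: bK.
have mem i (x y : R) : (i <= j + k + b + k)%N -> centre R (horseshoe i) = (x, y) -> K (x, y).
  by move=> il <-; apply: conv_hull_sub; exists (horseshoe i) => //=; exact: mem_horseshoe.
have corner i (x y : int) : (i <= j + k + b + k)%N -> horseshoe i = (x, y) -> K (x%:~R, y%:~R).
  by move=> il E; apply: (mem i) => //; rewrite E.
have KA : K (- j%:R, 0).
  have := corner 0%N (- j%:Z) 0 isT; rewrite rmorphN /=; apply.
  by rewrite /horseshoe; congr pair; lia.
have KO : K (0, 0).
  by apply: (corner j 0 0); [lia|rewrite /horseshoe; congr pair; lia].
have KB : K (k%:R, 0).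
  by apply: (corner (j + k)%N k%:Z 0); [lia|rewrite /horseshoe; congr pair; lia].
have KC : K (k%:R, b%:R).
  by apply: (corner (j + k + b)%N k%:Z b%:Z); [lia|rewrite /horseshoe; congr pair; lia].
have KD : K (0, (b + k)%:R).
  by apply: (corner (j + k + b + k)%N 0 (b + k)%:Z); [lia|rewrite /horseshoe; congr pair; lia].
pose g (x : R) := (-1 * x + (b + k)%:R) * \1_`[0, k%:R] x +
  ((b + k)%:R * x + (b + k)%:R * j%:R) * \1_`[- j%:R, 0[ x.
have right x : 0 <= x <= k%:R -> K (x, 0) /\ K (x, (b + k)%:R - x).
  move=> /andP[x0 xk]; have [k0|kn0] := eqVneq k 0%N.
    have -> : x = 0 by apply/le_anti; rewrite x0 andbT (le_trans xk)// k0.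
    by rewrite subr0.
  have kp : 0 < k%:R :> R by rewrite ltr0n lt0n.
  have t01 : 0 <= x / k%:R <= 1 by rewrite divr_ge0 ?ler_pdivrMr ?mul1r ?xk ?(ltW kp).
  split.
    have -> : (x, 0) = mix (x / k%:R) (0, 0) (k%:R, 0).
      by rewrite /mix/=; congr pair; field; rewrite gt_eqF.
    exact: vK.
  have -> : (x, (b + k)%:R - x) = mix (x / k%:R) (0, (b + k)%:R) (k%:R, b%:R).
    by rewrite /mix/= natrD; congr pair; field; rewrite gt_eqF.
  exact: vK.
have left x : - j%:R <= x < 0 -> K (x, 0) /\ K (x, (b + k)%:R * x + (b + k)%:R * j%:R).
  case: (j) j1 KA => [|[|//]] _ KA /andP[x1 x0]; first by lra.
  have t01 : 0 <= x + 1 <= 1 by lra.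
  split.
    by have := vK _ _ _ KA KO t01; rewrite /mix/=; congr (K (_, _)); ring.
  by have := vK _ _ _ KA KD t01; rewrite /mix/=; congr (K (_, _)); ring.
have slice x h : 0 <= h -> K (x, 0) -> K (x, h) -> (h%:E <= lebesgue_measure (xsection K x))%E.
  move=> h0 K0 Kh; rewrite -[h]subr0 -lebesgue_segment//; apply: le_measure.
  - by rewrite inE; exact: measurable_itv.
  - by rewrite inE; apply: measurable_xsection; exact: body_measurable.
  - by move=> y; rewrite /= in_itv/= => yh; apply/xsectionP; exact: mix_closed_vertical Kh yh.
have gle x : ((g x)%:E <= lebesgue_measure (xsection K x))%E.
  rewrite /g !indicE !mem_setE/= !in_itv/=.
  have [x0|x0] := ltP x 0.
    rewrite andbT/= mulr0 add0r; case: (leP (- j%:R) x) => xj; last by rewrite /= mulr0 measure_ge0.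
    have [|K0 Kh] := left x; first by rewrite xj.
    by rewrite mulr1; apply: slice => //; rewrite -mulrDr mulr_ge0//; lra.
  rewrite andbF mulr0 addr0/=; case: (leP x k%:R) => xk; last by rewrite /= mulr0 measure_ge0.
  have [|K0 Kh] := right x; first by rewrite x0.
  rewrite mulr1 mulN1r addrC; apply: slice => //.
  by rewrite natrD; have : 0 <= b%:R :> R by []; lra.
have g1 (x : R) : 0 <= (-1 * x + (b + k)%:R) * \1_`[0, k%:R] x.
  rewrite indicE mem_setE/= in_itv/=; case: andP => [[]|] x0; last by rewrite mulr0.
  by rewrite mulr1 natrD; have : 0 <= b%:R :> R by []; lra.
have g2 (x : R) : 0 <= ((b + k)%:R * x + (b + k)%:R * j%:R) * \1_`[- j%:R, 0[ x.
  rewrite indicE mem_setE/= in_itv/=; case: andP => [[xj _]|_]; last by rewrite mulr0.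
  by rewrite mulr1 -mulrDr mulr_ge0//; lra.
have mg1 := @measurable_affine_on R (-1) (b + k)%:R _ (measurable_itv `[0, k%:R]).
have mg2 := @measurable_affine_on R (b + k)%:R ((b + k)%:R * j%:R) _ (measurable_itv `[- j%:R, 0[).
have -> : ((2 * k * b + k * k + j * (b + k))%N%:R / 2)%:E =
    (\int[@lebesgue_measure R]_x (g x)%:E)%E.
  rewrite /g; under eq_integral do rewrite EFinD.
  rewrite ge0_integralD//; last first.
  - exact/measurable_EFinP.
  - by move=> x _; rewrite lee_fin.
  - exact/measurable_EFinP.
  - by move=> x _; rewrite lee_fin.
  rewrite !integral_on integral_affine// integral_itv_bndo_bndc; last first.
    by apply/measurable_EFinP; apply: measurable_funD => //; apply: measurable_funM.
  rewrite integral_affine ?oppr_le0// -EFinD; congr EFin.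
  rewrite !(natrD, natrM).
  by case: (j) j1 => [|[|//]] _; field.
rewrite areaE.
apply: ge0_le_integral => //.
- by move=> x _; rewrite lee_fin addr_ge0.
- by apply/measurable_EFinP; apply: measurable_funD.
- by apply: measurable_fun_xsection; exact: body_measurable.
Qed.

Lemma hull_area_horseshoe : (j <= 1)%N -> (j <= b + k)%N ->
  ((1 / 6 * (3 * (2 * k * b + k * k + j * (b + k)) + 2 * (4 * b + 6 * k + 3 * j) + 6)%N%:R)%:E <=
  hull_area R horseshoe_polyhex)%E.
Proof.
move=> j1 jb; have s0 : horseshoe_cells != [::] by [].
have [x1 [y1 [x2 [y2 [x3 [y3 [sp1 sp2 sp3 W]]]]]]] := horseshoe_width jb.
have sP : horseshoe_cells =i horseshoe_polyhex by move=> p; rewrite seq_fsetE.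
rewrite (hull_area_cells _ sP) area_hull_cells// (area_fatten _ s0 sp1 sp2 sp3) {}W.
apply: le_trans (leeD (horseshoe_area j1) (lexx _)).
by rewrite -EFinD lee_fin -pmulrn !natrD !natrM; lra.
Qed.
End Extremal.

(** The legs have lengths [j + k], [b] and [k].  To share [n - 1] steps as evenly as
    possible, the first surplus step goes to the middle leg, where a step adds 4 to
    the widths instead of 3, and the second to the first leg. *)
Lemma horseshoe_exists (n : nat) : (0 < n)%N -> exists j k b : nat,
  [/\ (j <= 1)%N, (j <= b + k)%N, n = (j + k + b + k).+1 &
    let N := (3 * (2 * k * b + k * k + j * (b + k)) + 2 * (4 * b + 6 * k + 3 * j) + 6)%N in
    (3 * n * n + 14 * n <= 3 * N <= 3 * n * n + 14 * n + 2)%N].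
Proof.
move=> n0; pose k := (n.-1 %/ 3)%N.
have : n = (3 * k + 1)%N \/ n = (3 * k + 2)%N \/ n = (3 * k + 3)%N by rewrite /k; lia.
by case=> [->|[->|->]]; [exists 0%N, k, k|exists 0%N, k, k.+1|exists 1%N, k, k.+1]; split; lia.
Qed.

Theorem theorem2 (R : realType) (n : nat) (n_gt0 : (0 < n)%N) :
  let x : R := n%:R ^+ 2 + 14 / 3 * n%:R in
  [/\ hull_areas R n (max_hull_area R n),
      max_hull_area R n = (1 / 6 * (Num.ceil x)%:~R)%:E
    & max_hull_area R n =
        (1 / 6 * ((Num.floor (x + 1))%:~R - (3 %| n)%N%:R))%:E].
Proof.
move=> x; have [j [k [b [j1 jbk nE]]]] := horseshoe_exists n_gt0.
set N := (_ + 6)%N => /= /andP[Nlow Nup].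
have xE : 3 * x = (3 * n * n + 14 * n)%N%:R.
  by rewrite /x natrD !natrM; field.
have ub (P : {fset int * int}) : polyhex R n P -> (hull_area R P <= (1 / 6 * N%:R)%:E)%E.
  move=> /(hull_area_bound n_gt0)[m mle]; move=> /le_trans; apply.
  have mN : m <= N%:Z by lia.
  by rewrite lee_fin ler_pM2l ?divr_gt0// -[N%:R]/(N%:Z%:~R) ler_int.
have poly : polyhex R n (horseshoe_polyhex j k b) by rewrite nE; exact: polyhex_horseshoe.
have eqN : hull_area R (horseshoe_polyhex j k b) = (1 / 6 * N%:R)%:E.
  by apply/le_anti; rewrite ub//= hull_area_horseshoe.
clearbody N; have maxE : max_hull_area R n = (1 / 6 * N%:R)%:E.
  apply/le_anti/andP; split.
    by apply: ge_ereal_sup => _ [P PP <-]; exact: ub.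
  by rewrite -eqN; apply: ereal_sup_ubound; exists (horseshoe_polyhex j k b).
have ceilE : Num.ceil x = N%:Z.
  apply: ceil_def; rewrite rmorphB /= -pmulrn.
  have : (3 * n * n + 14 * n)%N%:R <= (3 * N)%N%:R :> R by rewrite ler_nat.
  have : (3 * N)%N%:R <= (3 * n * n + 14 * n + 2)%N%:R :> R by rewrite ler_nat.
  by rewrite natrD -xE natrM => h1 h2; apply/andP; split; lra.
have floorE : Num.floor (x + 1) = (N + (3 %| n))%N%:Z.
  apply: floor_def; rewrite [(_ + 1)%:~R]rmorphD /= -!pmulrn natrD.
  have : (3 * (N + (3 %| n)))%N%:R <= (3 * n * n + 14 * n + 3)%N%:R :> R.
    by rewrite ler_nat; lia.
  have : (3 * n * n + 14 * n + 3)%N%:R < (3 * (N + (3 %| n) + 1))%N%:R :> R.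
    by rewrite ltr_nat; lia.
  rewrite (natrD _ _ 3) -xE !natrM !natrD => h1 h2.
  by apply/andP; split; lra.
split; rewrite maxE.
- by exists (horseshoe_polyhex j k b).
- by rewrite ceilE.
- by rewrite floorE -pmulrn natrD addrK.
Qed.
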